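(* Let $\Omega$, $\varphi_P$ and $\varphi_{\beta,w}$ be as defined in the context, and for $\omega\in\Omega$ put $\varphi_\omega=\varphi_P$ if $\omega=P$ and $\varphi_\omega=\varphi_{\beta,w}$ if $\omega=(\beta,w)$. Then the map $\omega\mapsto\varphi_\omega$ is a homeomorphism of $\Omega$ onto the Martin boundary $E$ of the Young–Fibonacci lattice. Consequently, for each Borel probability measure $M$ on $\Omega$, the function $\varphi(v)=\int_\Omega\varphi_\omega(v)\,M(d\omega)$, $v\in\mathbb{YF}$, is a nonnegative harmonic function on $\mathbb{YF}$ with $\varphi(\varnothing)=1$; conversely, every nonnegative harmonic function $\varphi$ on $\mathbb{YF}$ with $\varphi(\varnothing)=1$ admits such an integral representation with respect to some (not necessarily unique) Borel probability measure $M$ on $\Omega$.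
   Context: Young–Fibonacci lattice: a Fibonacci word is a finite word in the alphabet $\{1,2\}$ (including the empty word $\varnothing$); its rank $|v|$ is the sum of its digits, and $\mathbb{YF}_n$ is the set of words of rank $n$, $\mathbb{YF}=\bigcup_n\mathbb{YF}_n$. The head of $v$ is the maximal block of consecutive 2's at the left end of $v$. Write $v\nearrow w$ if $w$ is obtained from $v$ by one of: (i) adding a letter 1 at the left end of $v$; (ii) replacing the leftmost 1 of $v$ by 2; (iii) inserting a 1 between two consecutive 2's of the head of $v$, or immediately after the last 2 of the head. For $u,v\in\mathbb{YF}$, $d(u,v)$ is the number of chains $u=x_0\nearrow x_1\nearrow\cdots\nearrow x_r=v$ (so $d(u,u)=1$), and $d(v)=d(\varnothing,v)$. If $v=v_12v_2$, the position of the indicated 2 is $|v_2|+1$. A function $\varphi:\mathbb{YF}\to\mathbb R$ is harmonic if $\varphi(u)=\sum_{w:u\nearrow w}\varphi(w)$ for all $u$. Martin boundary: let $K(v,w)=d(v,w)/d(w)$. In $\mathbb R^{\mathbb{YF}}$ with the topology of pointwise convergence, let $\widetilde E$ be the closure of $\widetilde\Gamma=\{K(\cdot,w):w\in\mathbb{YF}\}$; the Martin boundary is $E=\widetilde E\setminus\widetilde\Gamma$. Okada ring: $R=\mathbb Q\langle X,Y\rangle$ (non-commuting variables), graded by $\deg X=1,\deg Y=2$, with degree-$n$ part $R_n$. The noncommutative determinant is $\det(a_{ij})=\sum_{\sigma\in S_n}\mathrm{sgn}(\sigma)a_{\sigma(1)1}a_{\sigma(2)2}\cdots a_{\sigma(n)n}$.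 $P_n$ ($n\ge0$, $P_0=1$) is the $n\times n$ determinant of the tridiagonal matrix with $X$ on the diagonal, $Y$ on the superdiagonal and $1$ on the subdiagonal; for $n\ge1$, $Q_{n-1}$ is the determinant of the $n\times n$ matrix obtained from the matrix of $P_n$ by replacing its first row by $(Y,Y,0,\dots,0)$ and its second row by $(X,X,Y,0,\dots,0)$ (so $Q_0=Y$). For $v=1^{k_t}21^{k_{t-1}}2\cdots1^{k_1}21^{k_0}$ ($t\ge0$, $k_i\ge0$) put $s_v=P_{k_0}Q_{k_1}\cdots Q_{k_t}$ and $p_v=(X^{k_0+2}-(k_0+2)X^{k_0}Y)\cdots(X^{k_{t-1}+2}-(k_{t-1}+2)X^{k_{t-1}}Y)X^{k_t}$. Both $\{s_v\}_{v\in\mathbb{YF}_n}$ and $\{p_v\}_{v\in\mathbb{YF}_n}$ are bases of $R_n$. Infinite words: an infinite Fibonacci word $w=\cdots a_3a_2a_1$ extends infinitely to the left; the position of a 2 at letter $a_i$ is $1+\sum_{l<i}a_l$. $w$ is summable if $\sum_j1/d_j<\infty$ where $d_1<d_2<\cdots$ are the positions of its 2's; $\pi(w)=\prod_{j:d_j\ge2}(1-1/d_j)$. For summable $w$, $\varphi_w$ is the linear functional on $R$ with $\varphi_w(p_u)=\prod_{i=1}^m\prod_{j:\delta_i\le d_j<\delta_{i+1}}\bigl(1-\frac{\delta_i+1}{d_j}\bigr)$ for every finite word $u$, where $\delta_1<\dots<\delta_m$ are the positions of 2's in $u$ and $\delta_{m+1}=\infty$; we also write $\varphi_w(v)=\varphi_w(s_v)$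 for $v\in\mathbb{YF}$. For $\beta\in[0,1]$ and a harmonic function $\varphi$, $C_\beta(\varphi)(v)=\sum_{k=0}^n\frac{\beta^k(1-\beta)^{n-k}}{(n-k)!}\sum_{|u|=k}\varphi(u)d(u,v)$, $n=|v|$. Set $\varphi_{\beta,w}=C_\beta(\varphi_w)$ and $\varphi_P(v)=d(v)/|v|!$. Parameter space: $\Omega=\{P\}\cup\{(\beta,w):0<\beta\le1,\ w\text{ summable infinite word}\}$, with the topology in which a sequence $(\beta^{(n)},w^{(n)})$ converges to $P$ iff $\beta^{(n)}\to0$ or $\pi(w^{(n)})\to0$, and converges to $(\beta,w)$ iff $w^{(n)}\to w$ digitwise and $\beta^{(n)}\pi(w^{(n)})\to\beta\pi(w)$.
   Formalization: No topology on Ω has exactly the stated convergent sequences to P (interleave one with β→0 and one with π→0); Ω carries the sequential topology these convergences generate, in which convergence to P means βπ(w)→0 and convergence to (β,w) is as stated. *)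

(* Defs.v *)
From HB Require Import structures.
From mathcomp Require Import all_boot all_order all_algebra all_fingroup finmap.
From mathcomp Require Import all_classical all_reals all_analysis.
From mathcomp Require Import zify.
From mathcomp Require Import -(notations) monalg.

Set Implicit Arguments.
Unset Strict Implicit.
Unset Printing Implicit Defensive.

Import Order.TTheory GRing.Theory Num.Theory.
Import numFieldNormedType.Exports.
Local Open Scope classical_set_scope.
Local Open Scope ring_scope.

(* The letter 1 is [false] and the letter 2 is [true], so that the value of
   the letter [a] is [a.+1].  The head of the list is the left end of the
   word. *)
Definition fword := seq bool.

Definition wrank (v : fword) : nat := (\sum_(a <- v) a.+1)%N.

(* [index false v] is the length of the maximal block of 2's at the left end
   of [v]; the letter following that block, if any, is the leftmost 1. *)
Definition yf_up (v w : fword) : bool :=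
  [|| w == false :: v,
      (false \in v) && (w == set_nth true v (index false v) true)
    | [exists i : 'I_(index false v), w == take i.+1 v ++ false :: drop i.+1 v]].

Definition chains (u v : fword) : set (seq fword) :=
  [set c | path yf_up u c && (last u c == v)].

Definition nchains (u v : fword) : nat := #|` fset_set (chains u v)|.

Definition dim (v : fword) : nat := nchains [::] v.

Fixpoint words (n : nat) : seq fword :=
  match n with
  | 0 => [:: [::]]
  | 1 => [:: [:: false]]
  | (n'.+1 as m).+1 => map (cons false) (words m) ++ map (cons true) (words n')
  end%N.

Lemma wrank_cons a v : wrank (a :: v) = (a.+1 + wrank v)%N.
Proof. by rewrite /wrank big_cons. Qed.

Lemma wrank_cat u v : wrank (u ++ v) = (wrank u + wrank v)%N.
Proof. by rewrite /wrank big_cat. Qed.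

Lemma wordsSS n :
  words n.+2 = map (cons false) (words n.+1) ++ map (cons true) (words n).
Proof. by []. Qed.

Lemma mem_words n v : (v \in words n) = (wrank v == n).
Proof.
have mapE (a b : bool) (u : fword) s :
    (b :: u \in map (cons a) s) = (b == a) && (u \in s).
  elim: s => [|x s IH] /=; first by rewrite in_nil andbF.
  by rewrite !in_cons IH eqseq_cons andb_orr.
have map0 (a : bool) (s : seq fword) : ([::] \in map (cons a) s) = false.
  by elim: s.
have [m] := ubnP n; elim: m n v => // m IH [|[|n]] [|a v] lenm.
- by rewrite /wrank big_nil.
- by rewrite wrank_cons.
- by rewrite /wrank big_nil.
- rewrite in_cons in_nil orbF wrank_cons eqseq_cons.
  by case: a; case: v => [|b v]; rewrite /= ?wrank_cons ?/wrank ?big_nil.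
- by rewrite wordsSS mem_cat !map0 /wrank big_nil.
- rewrite wordsSS mem_cat !mapE wrank_cons.
  case: a; last by rewrite orbF andTb IH.
  have lenm' := ltnW lenm.
  exact: IH.
Qed.

Lemma words_uniq n : uniq (words n).
Proof.
have [m] := ubnP n; elim: m n => // m IH [|[|n]] // lenm.
have injc (a : bool) : injective (cons a) by move=> ? ? [].
rewrite wordsSS cat_uniq !map_inj_uniq// !IH//; last exact: ltnW lenm.
rewrite andbT; apply/hasPn => _ /mapP[u _ ->]; apply/negP.
by move=> /mapP[].
Qed.

Lemma yf_up_wrank v w : yf_up v w -> wrank w = (wrank v).+1.
Proof.
case/or3P=> [/eqP->|/andP[v1 /eqP->]|/existsP[i /eqP->]].
- by rewrite wrank_cons.
- have ltv : (index false v < size v)%N by rewrite index_mem.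
  rewrite set_nthE ltv wrank_cat wrank_cons.
  rewrite -[in RHS](cat_take_drop (index false v) v) wrank_cat.
  rewrite [in RHS](drop_nth true)// nth_index// wrank_cons; lia.
- by rewrite wrank_cat wrank_cons addnCA -wrank_cat cat_take_drop.
Qed.

Lemma finite_chains u v : finite_set (chains u v).
Proof.
pose ws := flatten [seq words k | k <- iota 0 (wrank v).+1].
pose f n : seq (seq fword) := iter n
  (fun s => [seq x :: c | x <- ws, c <- s]) [:: [::]].
have wsP x : (wrank x <= wrank v)%N -> x \in ws.
  move=> xv; apply/flatten_mapP; exists (wrank x); last by rewrite mem_words.
  by rewrite mem_iota.
have pathf c : forall x, path yf_up x c -> last x c = v ->
    (wrank x + size c)%N = wrank v /\ c \in f (size c).
  elim: c => [|y c IH] x /=; first by move=> _ ->; rewrite addn0.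
  case/andP=> /yf_up_wrank xy yc lc; have [rv cf] := IH _ yc lc.
  split; first by rewrite -rv xy addnS.
  change (y :: c \in [seq x' :: c' | x' <- ws, c' <- f (size c)]).
  by apply: allpairs_f => //; apply: wsP; rewrite -rv leq_addr.
apply: (@sub_finite_set _ _ [set` flatten [seq f n | n <- iota 0 (wrank v).+1]]).
  move=> c /andP[uc /eqP lc]; have [rv cf] := pathf _ _ uc lc.
  by apply/flatten_mapP; exists (size c); rewrite // mem_iota ltnS -rv leq_addl.
exact: finite_seq.
Qed.

Section Harmonic.
Variable R : realType.

Definition harmonic (f : fword -> R) : Prop :=
  forall u, f u = \sum_(w <- words (wrank u).+1 | yf_up u w) f w.

Definition nonneg_normalized_harmonic (f : fword -> R) : Prop :=
  [/\ forall v, 0 <= f v, harmonic f & f [::] = 1].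

Definition martin_kernel (w v : fword) : R := (nchains v w)%:R / (dim w)%:R.

Definition martin_image : set {ptws fword -> R} :=
  range (martin_kernel : fword -> {ptws fword -> R}).

Definition martin_boundary : set {ptws fword -> R} :=
  closure martin_image `\` martin_image.

End Harmonic.

Arguments martin_boundary : clear implicits.

Local Notation fmon := (monalg.fmonom bool).

Definition okada := monalg.malg fmon rat.
HB.instance Definition _ := GRing.Lalgebra.on okada.

Definition okX : okada := @monalg.mkmalgU fmon rat (monalg.fmu false) 1.
Definition okY : okada := @monalg.mkmalgU fmon rat (monalg.fmu true) 1.

(* The entries do not commute: each product is taken in the order of the
   columns. *)
Definition ncdet (n : nat) (A : 'M[okada]_n) : okada :=
  \sum_(s : 'S_n) (-1) ^+ s * \prod_(j < n) A (s j) j.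

Definition Pentry (i j : nat) : okada :=
  if i == j then okX else if j == i.+1 then okY else if i == j.+1 then 1 else 0.

Definition Qentry (i j : nat) : okada :=
  match i with
  | 0%N => if (j <= 1)%N then okY else 0
  | 1%N => if (j <= 1)%N then okX else if j == 2%N then okY else 0
  | _ => Pentry i j
  end.

Definition okP (n : nat) : okada := ncdet (\matrix_(i < n, j < n) Pentry i j).

Definition okQ (n : nat) : okada :=
  ncdet (\matrix_(i < n.+1, j < n.+1) Qentry i j).

(* For v = 1^{k_t} 2 1^{k_{t-1}} 2 ... 2 1^{k_0}, this is the list
   [:: k_t; ...; k_0], of size t + 1. *)
Fixpoint runs (v : fword) : seq nat :=
  match v with
  | [::] => [:: 0%N]
  | true :: v' => 0%N :: runs v'
  | false :: v' => (head 0%N (runs v')).+1 :: behead (runs v')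
  end.

Definition ntwos (v : fword) : nat := count id v.
Definition run (v : fword) (i : nat) : nat := nth 0%N (rev (runs v)) i.

Definition ok_s (v : fword) : okada :=
  okP (run v 0) * \prod_(1 <= i < (ntwos v).+1) okQ (run v i).

Definition ok_p (v : fword) : okada :=
  (\prod_(0 <= i < ntwos v)
     (okX ^+ (run v i + 2)%N - (run v i + 2)%:R * okX ^+ run v i * okY))
  * okX ^+ run v (ntwos v).

(* [w i] is the (i+1)-st letter of the infinite word counted from the right. *)
Definition infword := nat -> bool.

Definition letter_pos (w : infword) (i : nat) : nat := (\sum_(l < i) (w l).+1).+1.

(* Positions of the 2's of a finite word, in increasing order. *)
Fixpoint twos (u : fword) : seq nat :=
  match u with
  | [::] => [::]
  | a :: u' => if a then rcons (twos u') (wrank u').+1 else twos u'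
  end.

Section Boundary.
Variable R : realType.
Implicit Type w : infword.

Definition summable_word w : Prop :=
  cvgn (fun N => \sum_(l < N | w l) (letter_pos w l)%:R^-1 : R).

Definition piw w : R :=
  limn (fun N => \prod_(l < N | w l && (2 <= letter_pos w l)%N)
                   (1 - (letter_pos w l)%:R^-1) : R).

(* The block of factors attached to the [i]-th 2 of [u], counted from 0; for
   the last one there is no upper bound on the positions in [w]. *)
Definition phi_p_block w (u : fword) (i : nat) : R :=
  let delta := nth 0%N (twos u) in
  limn (fun N => \prod_(l < N | [&& w l, (delta i <= letter_pos w l)%N &
                      (i.+1 < size (twos u))%N ==> (letter_pos w l < delta i.+1)%N])
                   (1 - (delta i).+1%:R / (letter_pos w l)%:R) : R).

Definition phi_p w (u : fword) : R := \prod_(i < size (twos u)) phi_p_block w u i.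

Definition rat_linear (f : okada -> R) : Prop :=
  forall (a : rat) (x y : okada), f (a *: x + y) = ratr a * f x + f y.

(* The polynomials [ok_p u] form a basis of the Okada ring, so that the
   functional selected here is the unique one with the given values.  The
   argument of [xget] before the set is the default for an empty set. *)
Definition phi_functional w : okada -> R :=
  xget (fun=> 0) [set f | rat_linear f /\ forall u, f (ok_p u) = phi_p w u].

Definition phi_word w (v : fword) : R := phi_functional w (ok_s v).

Definition contraction (beta : R) (f : fword -> R) (v : fword) : R :=
  \sum_(0 <= k < (wrank v).+1)
     beta ^+ k * (1 - beta) ^+ (wrank v - k) / ((wrank v - k)`!)%:R *
     \sum_(u <- words k) f u * (nchains u v)%:R.

Definition phi_plancherel (v : fword) : R := (dim v)%:R / ((wrank v)`!)%:R.

Record om_point := OmPoint {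
  om_beta : R;
  om_word : infword;
  om_beta_itv : 0 < om_beta <= 1;
  om_word_summable : summable_word om_word }.

(* [None] is the point P. *)
Definition Omega := option om_point.

HB.instance Definition _ := gen_eqMixin Omega.
HB.instance Definition _ := gen_choiceMixin Omega.
HB.instance Definition _ := isPointed.Build Omega None.

Definition phi_Omega (o : Omega) : {ptws fword -> R} :=
  if o is Some x then contraction (om_beta x) (phi_word (om_word x))
  else phi_plancherel.

Definition conv_Omega (x : nat -> om_point) (o : Omega) : Prop :=
  match o with
  | None => (om_beta (x n) @[n --> \oo] --> (0 : R)) \/
            (piw (om_word (x n)) @[n --> \oo] --> (0 : R))
  | Some y => (forall i, \forall n \near \oo, om_word (x n) i = om_word y i) /\
              (om_beta (x n) * piw (om_word (x n)) @[n --> \oo]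
                 --> om_beta y * piw (om_word y))
  end.

(* The topology determined by the convergence [conv_Omega]: a set is open if it
   eventually contains every sequence which converges to one of its points.
   Interleaving a sequence with beta -> 0 and one with pi -> 0 gives a sequence
   which also converges to P; [Omega_cvgP] below states that convergence to P
   amounts to beta * pi -> 0. *)
Definition Omega_open (U : set Omega) : Prop :=
  forall (x : nat -> om_point) (o : Omega),
    U o -> conv_Omega x o -> \forall n \near \oo, U (Some (x n)).

Lemma Omega_openT : Omega_open setT.
Proof. by move=> x o _ _; apply: nearW. Qed.

Lemma Omega_openI : setI_closed Omega_open.
Proof.
move=> A B oA oB x o [Ao Bo] xo.
by near=> n; split; near: n; [exact: oA xo|exact: oB xo].
Unshelve. all: by end_near. Qed.

Lemma Omega_open_bigU (I : Type) (f : I -> set Omega) :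
  (forall i, Omega_open (f i)) -> Omega_open (\bigcup_i f i).
Proof.
move=> of_ x o [i _ fio] xo; near=> n; exists i => //.
by near: n; exact: of_ xo.
Unshelve. all: by end_near. Qed.

HB.instance Definition _ := isOpenTopological.Build Omega
  Omega_openT Omega_openI Omega_open_bigU.

Lemma piw_itv w : 0 <= piw w <= 1.
Proof.
set u := (fun N => \prod_(l < N | w l && (2 <= letter_pos w l)%N)
                   (1 - (letter_pos w l)%:R^-1) : R).
have f01 l : w l && (2 <= letter_pos w l)%N ->
    0 <= 1 - ((letter_pos w l)%:R^-1 : R) <= 1.
  by move=> _; rewrite subr_ge0 lerBlDr lerDl invr_ge0 ler0n invf_le1 ?ler1n ?ltr0n.
have u0 N : 0 <= u N by apply: prodr_ge0 => l /f01/andP[].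
have u1 N : u N <= 1 by apply: prodr_ile1 => l /f01.
have cu : cvgn u.
  apply: nonincreasing_is_cvgn.
    apply/nonincreasing_seqP => N; rewrite /u big_mkcond big_ord_recr -big_mkcond.
    by case: ifP => /= [/f01/andP[_ h]|_]; rewrite ?mulr1// ler_piMr//; exact: u0.
  by exists 0 => _ [N _ <-]; exact: u0.
rewrite /piw; apply/andP; split.
  by apply: limr_ge => //; apply: nearW.
by apply: limr_le => //; apply: nearW.
Qed.

Lemma Omega_cvgP (x : nat -> om_point) (o : Omega) :
  Some (x n) @[n --> \oo] --> o <->
  match o with
  | None => om_beta (x n) * piw (om_word (x n)) @[n --> \oo] --> (0 : R)
  | Some y => conv_Omega x (Some y)
  end.
Proof.
pose t (o : Omega) : R :=
  if o is Some y then om_beta y * piw (om_word y) else 0.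
have b01 y : 0 <= om_beta y <= 1.
  by have /andP[/ltW-> ->] := om_beta_itv y.
have t0 y : 0 <= t (Some y).
  have /andP[b0 _] := b01 y; have /andP[p0 _] := piw_itv (om_word y).
  exact: mulr_ge0.
have tb y : t (Some y) <= om_beta y.
  by have /andP[b0 _] := b01 y; have /andP[_ p1] := piw_itv (om_word y);
    exact: ler_piMr.
have tp y : t (Some y) <= piw (om_word y).
  by have /andP[_ b1] := b01 y; have /andP[p0 _] := piw_itv (om_word y);
    exact: ler_piMl.
have cvgt z p : conv_Omega z p -> t (Some (z n)) @[n --> \oo] --> t p.
  case: p => [y [] //|[z0|z0]];
    by apply: (squeeze_cvgr _ (cvg_cst 0) z0); apply: nearW => n;
      rewrite t0 ?tb ?tp.
have cvg_open U : Omega_open U -> U o -> Some (x n) @[n --> \oo] --> o ->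
    \forall n \near \oo, U (Some (x n)).
  by move=> oU Uo; apply; exact: open_nbhs_nbhs.
have tcvg : Some (x n) @[n --> \oo] --> o -> t (Some (x n)) @[n --> \oo] --> t o.
  move=> xo; apply/cvgrPdist_lt => e e0.
  apply: (cvg_open [set p | `|t o - t p| < e]) => //=; last by rewrite subrr normr0.
  move=> z p /= op /cvgt zp.
  have : open [set r | `|t o - r| < e].
    rewrite (_ : [set _ | _] = ball (t o) e); first exact: ball_open.
    by rewrite -ball_normE.
  by move=> oA; exact: (zp _ (open_nbhs_nbhs (conj oA op))).
have conv_cvg p : conv_Omega x p -> Some (x n) @[n --> \oo] --> p.
  by move=> xp A [B [oB Bp BA]]; apply: filterS (oB x p Bp xp) => n /BA.
split.
  move=> xo; have := tcvg xo; case: o cvg_open xo {tcvg} => //= y cvg_open xo ty.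
  split=> // i; apply: (cvg_open [set p | if p is Some q then
     om_word q i = om_word y i else False]) => //.
  move=> z [p|]//= pi [/(_ i) + _]; apply: filterS => n ->; exact: pi.
case: o {cvg_open tcvg} => [y /conv_cvg//|x0].
move=> A [B [oB BN BA]]; apply: filterS BA _; rewrite -[_ B]/(nbhs _ _) /=.
apply: contrapT => nB.
have inv0 k : 0 < k.+1%:R^-1 :> R by rewrite invr_gt0.
have bad k : exists n, ~ B (Some (x n)) /\ t (Some (x n)) < k.+1%:R^-1 * k.+1%:R^-1.
  apply: contrapT => h; apply: nB.
  have e0 : 0 < k.+1%:R^-1 * k.+1%:R^-1 :> R by rewrite mulr_gt0.
  move/cvgrPdist_lt : x0 => /(_ _ e0); apply: filterS => n.
  rewrite sub0r normrN ger0_norm ?t0// => tn; apply: contrapT => nBn.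
  by apply: h; exists n.
have key (g : om_point -> R) : (forall p, 0 <= g p) ->
    (forall k, exists n, ~ B (Some (x n)) /\ g (x n) < k.+1%:R^-1) ->
    exists z : nat -> om_point,
      (forall n, ~ B (Some (z n))) /\ g (z n) @[n --> \oo] --> (0 : R).
  move=> g0 /choice[f fP]; exists (x \o f); split=> [n|]; first by have [] := fP n.
  apply: (squeeze_cvgr _ (cvg_cst 0) (@cvg_harmonic R)); apply: nearW => n.
  by rewrite g0 /=; apply: ltW; have [] := fP n.
have contra z : (forall n, ~ B (Some (z n))) -> ~ conv_Omega z None.
  by move=> nBz zP; have [N _ /(_ N (leqnn N))/nBz] := oB z None BN zP.
have [hb|] := pselect (forall k, exists n,
    ~ B (Some (x n)) /\ om_beta (x n) < k.+1%:R^-1).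
  have [|z [nBz z0]] := key _ _ hb; first by move=> p; have /andP[] := b01 p.
  by apply: (contra z nBz); left.
move/existsNP => [k0 hk0].
have [| |z [nBz z0]] := key (fun p => piw (om_word p)).
- by move=> p; have /andP[] := piw_itv (om_word p).
- move=> k; have [n [nBn tn]] := bad (maxn k k0); exists n; split=> //.
  rewrite ltNge; apply/negP => kp; move: tn; rewrite ltNge => /negP; apply.
  apply: ler_pM; [exact: ltW|exact: ltW| |].
    rewrite leNgt; apply/negP => h; apply: hk0; exists n; split=> //.
    by apply: lt_le_trans h _; rewrite lef_pV2 ?posrE// ler_nat ltnS leq_maxr.
  by apply: le_trans kp; rewrite lef_pV2 ?posrE// ler_nat ltnS leq_maxl.
- by apply: (contra z nBz); right.
Qed.

Definition borel_Omega := g_sigma_algebraType (@open Omega).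

End Boundary.
HB.instance Definition _ (R : realType) := Measurable.on (borel_Omega R).

Definition homeomorphism_onto (S T : topologicalType) (f : S -> T)
    (E : set T) : Prop :=
  [/\ set_bij setT E f, continuous f &
      exists2 g : T -> S, cancel f g & {within E, continuous g}].

(* Main.v *)
(* Right multiplication by X and Y on the Okada ring is dual to two operators
   on functions on words, so a function h extends to a linear functional whose
   values on the basis p_u are again finite combinations of values of h, and
   conversely.  For h = K(., w) with w finite, the recursive structure of the
   graph turns these values into the product over the 2's of w which defines
   phi_w(p_u).  Comparing each factor with (1 - 1/d)^r, where r is the rank of
   u without its leading 1's, leaves a factor 1 - O(1/d^2); hence the product is
   J_u(w) pi(w)^r with J_u continuous in the digits of w.  The map C_beta
   multiplies the value at p_u by beta^r, so every phi_omega, including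
   phi_P, has the values J_u(w) t^r with t = beta pi(w), or t = 0 at P.
   Convergence of kernels thus amounts to convergence of the digits and of t,
   and compactness of the set of all pairs (w, t) yields the boundary.  Zeros
   and signs of J_u for u = 2 1^k recover the positions of the 2's of w, whence
   injectivity.

   For the integral representation, code the kernel K(., w) by a sequence of
   bits; the measures with mass phi(w) d(w) at each w of rank n have, along a
   subsequence, convergent masses on all cylinders.  Nested half-open
   subintervals of [0, 1) of these lengths give a map from [0, 1) to Omega, and
   the image of Lebesgue measure represents phi. *)

From Pilot Require Import Defs.
From mathcomp Require Import all_boot all_order all_algebra all_fingroup finmap.
From mathcomp Require Import all_classical all_reals all_analysis measurable_realfun.
From mathcomp Require Import zify ring lra.
From mathcomp Require Import -(notations) monalg.

(* [dim] and [harmonic] are also names of the libraries. *)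
Import Pilot.Defs.

Set Implicit Arguments.
Unset Strict Implicit.
Unset Printing Implicit Defensive.

Import Order.TTheory GRing.Theory Num.Theory.
Import numFieldNormedType.Exports.
Local Open Scope classical_set_scope.
Local Open Scope ring_scope.

(** Two relations between the operators carry the algebra: [Ut (Dt h) = Dt (Ut h) + h] and
    [Yt (Dt h) = Ut h]. They explain the coefficient [k + 2] in [ok_p]: with it the value of [Dt h]
    at [p_u] vanishes whenever [u] starts with 2, so that [Dt] acts on the values like
    differentiation of the leading power of X. The obstacle is that pi is not continuous in the
    digits: 2's moving off to the left disappear from the limit word but still lower the limit of
    pi. Limits of pairs (w, pi(w)) therefore fill the region 0 <= t <= pi(w), and beta = t / pi(w)
    records what was lost. At t = 0 the digits no longer matter and all pairs collapse to P; near P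
    the digits need not converge, so the arguments there pass to subsequences. Sequences suffice on
    both sides: the open sets of Omega are defined by them, and a function on the countable set of
    words has a countable neighbourhood basis. In the representation, half-open intervals of length
    zero are empty, so every bit prefix that occurs is the prefix of the code of an actual kernel of
    large rank. *)

(** * The covering relation *)

(* Reflection: the lower covers of [2v] are the upper covers of [v]. *)
Fixpoint downs (v : fword) : seq fword :=
  match v with
  | [::] => [::]
  | false :: v' => [:: v']
  | true :: v' => (false :: v') :: map (cons true) (downs v')
  end.

Definition ups (v : fword) : seq fword := downs (true :: v).

Arguments ups : simpl never.

Lemma upsE v : ups v = (false :: v) :: map (cons true) (downs v).
Proof. by []. Qed.

Lemma cons_inj (a : bool) : injective (cons a).
Proof. by move=> ? ? []. Qed.

Lemma mem_map_cons (a b : bool) (u : fword) s :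
  (b :: u \in map (cons a) s) = (b == a) && (u \in s).
Proof.
elim: s => [|x s IH] /=; first by rewrite in_nil andbF.
by rewrite !in_cons IH eqseq_cons andb_orr.
Qed.

Lemma nil_map_cons (a : bool) (s : seq fword) : ([::] \in map (cons a) s) =
  false.
Proof. by elim: s. Qed.

Lemma wrank_nil : wrank [::] = 0%N.
Proof. by rewrite /wrank big_nil. Qed.

Lemma wrank_one v : wrank (false :: v) = (wrank v).+1.
Proof. exact: wrank_cons. Qed.

Lemma wrank_two v : wrank (true :: v) = (wrank v).+2.
Proof. exact: wrank_cons. Qed.

Definition wrankE := (wrank_one, wrank_two, wrank_nil).

Lemma yf_up_nil w : yf_up [::] w = (w == [:: false]).
Proof.
rewrite /yf_up /=.
by case: existsP => [[[]]//|_]; rewrite orbF.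
Qed.

Lemma yf_up_one v w :
  yf_up (false :: v) w = (w == false :: false :: v) || (w == true :: v).
Proof.
rewrite /yf_up /=.
by case: existsP => [[[]]//|_]; rewrite orbF.
Qed.

(** Inserting a 1 right after the first 2 is prefixing a 1 to [v], and the other operations beyond
    the first letter are the same operations on [v]; this makes the relation recursive. *)
Lemma yf_up_two v w : yf_up (true :: v) w =
  (w == false :: true :: v) || (if w is true :: w' then yf_up v w' else false).
Proof.
rewrite /yf_up /= in_cons /=; congr orb.
apply/idP/idP.
  case/orP=> [/andP[fv /eqP->]|/existsP[[[|i] lti] /eqP->]] /=.
  - by rewrite fv eqxx !orbT.
  - by rewrite take0 drop0 eqxx.
  - apply/or3P; apply: Or33; apply/existsP.
    by exists (@Ordinal (index false v) i lti); rewrite /=.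
case: w => [|[] w]//; case/or3P=> [/eqP->|/andP[fv /eqP->]|/existsP[i /eqP->]].
- apply/orP; right; apply/existsP.
  by exists (@Ordinal (index false v).+1 0 isT); rewrite /= take0 drop0.
- by rewrite fv eqxx.
- apply/orP; right; apply/existsP.
  by exists (@Ordinal (index false v).+1 i.+1 (ltn_ord i)).
Qed.

Lemma yf_upE v w : yf_up v w = (w \in ups v).
Proof.
elim: v w => [|[] v IH] w.
- by rewrite yf_up_nil upsE /= inE.
- rewrite yf_up_two upsE /= in_cons; congr orb.
  case: w => [|[] w].
  - by rewrite in_cons nil_map_cons.
  - by rewrite IH upsE !in_cons mem_map_cons eqseq_cons.
  - by rewrite in_cons mem_map_cons.
- by rewrite yf_up_one upsE /= !inE.
Qed.

Lemma mem_ups_one u v : (false :: v \in ups u) = (u == v).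
Proof.
rewrite upsE in_cons mem_map_cons orbF eqseq_cons /= eq_sym.
by [].
Qed.

Lemma mem_ups_two u v : (true :: v \in ups u) = (v \in downs u).
Proof. by rewrite upsE in_cons mem_map_cons eqseq_cons. Qed.

Lemma mem_downs v u : (u \in downs v) = (v \in ups u).
Proof.
elim: v u => [|[] v IH] u.
- by rewrite upsE in_nil in_cons nil_map_cons.
- rewrite mem_ups_two.
  rewrite -/(ups v); case: u => [|[] u].
  + by rewrite upsE in_cons nil_map_cons.
  + by rewrite mem_ups_two IH.
  + by rewrite mem_ups_one /= inE eq_sym.
- by rewrite mem_ups_one /= inE.
Qed.

Lemma downs_uniq v : uniq (downs v).
Proof.
elim: v => [|[] v IH]//=; rewrite map_inj_uniq ?IH ?andbT; last exact: cons_inj.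
by rewrite mem_map_cons.
Qed.

Lemma ups_uniq v : uniq (ups v). Proof. exact: downs_uniq. Qed.

Lemma wrank_ups v w : w \in ups v -> wrank w = (wrank v).+1.
Proof. by rewrite -yf_upE => /yf_up_wrank. Qed.

Lemma wrank_downs u v : u \in downs v -> wrank v = (wrank u).+1.
Proof. by rewrite mem_downs => /wrank_ups. Qed.

Lemma sum_words_up (V : nmodType) (h : fword -> V) v :
  \sum_(w <- words (wrank v).+1 | yf_up v w) h w = \sum_(w <- ups v) h w.
Proof.
rewrite -big_filter; apply: perm_big; apply: uniq_perm.
- by rewrite filter_uniq// words_uniq.
- exact: ups_uniq.
move=> w; rewrite mem_filter mem_words yf_upE.
by case: (boolP (w \in ups v)) => //= /wrank_ups ->; rewrite eqxx.
Qed.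

Lemma mem_chainsP u v c :
  reflect (path yf_up u c /\ last u c = v) (c \in fset_set (chains u v)).
Proof.
rewrite in_fset_set; last exact: finite_chains.
by apply: (iffP idP) => [/set_mem/andP[uc /eqP]|[uc lc]]//; apply/mem_set;
  rewrite /chains /= uc lc eqxx.
Qed.

Lemma nchains_ups u v :
  nchains u v = ((u == v) + \sum_(x <- ups u) nchains x v)%N.
Proof.
move: (ups_uniq u) (yf_upE u); move: (ups u) => U uU upU.
pose S x : seq (seq fword) := fset_set (chains x v).
pose s := nseq (u == v) [::] ++ [seq x :: c | x <- U, c <- S x].
have -> : nchains u v = size s.
  apply: perm_size; apply: uniq_perm; first exact: fset_uniq.
    rewrite cat_uniq; apply/and3P; split; first by case: (u == v).
      apply/hasPn => _ /allpairsPdep[x [c [_ _ ->]]].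
      by case: (u == v).
    apply: allpairs_uniq_dep; first exact: uU.
      by move=> x _; exact: fset_uniq.
    by move=> [x c] [y d] _ _ [-> ->].
  move=> c; rewrite mem_cat; apply/mem_chainsP/orP.
    case: c => [|x c] /= [].
      by move=> _ ->; left; rewrite eqxx.
    case/andP=> ux xc lc; right; apply/allpairsPdep; exists x, c.
    by split; rewrite -?upU//; apply/mem_chainsP.
  case=> [|/allpairsPdep[x [d [ux /mem_chainsP[xd ld] ->]]]] /=.
    by have [->|//] := eqVneq u v; rewrite inE => /eqP->.
  by rewrite upU ux.
rewrite size_cat size_nseq size_allpairs_dep sumnE big_map.
by congr addn.
Qed.

Lemma nchains_gt u v : (wrank v < wrank u)%N -> nchains u v = 0%N.
Proof.
move=> vu; apply/eqP; rewrite cardfs_eq0; apply/eqP/fsetP => c;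
  rewrite in_fset0.
apply/mem_chainsP => -[]; elim: c u vu => [|x c IH] u vu /=.
  by move=> _ uv; rewrite uv ltnn in vu.
by case/andP=> /yf_up_wrank ux; apply: IH; rewrite ux ltnS ltnW.
Qed.

Lemma nchains_eq_rank u v : wrank v = wrank u -> nchains u v = (u == v).
Proof.
move=> vu; rewrite nchains_ups big_seq big1 ?addn0// => x /wrank_ups xu.
by rewrite nchains_gt// vu xu.
Qed.

Lemma sum_pred1 (T : eqType) (s : seq T) x : uniq s ->
  (\sum_(y <- s) (x == y : nat) = (x \in s))%N.
Proof.
elim: s => [|y s IH] /=; first by rewrite big_nil.
case/andP=> ys us; rewrite big_cons in_cons IH//.
by have [->|] := eqVneq x y; rewrite ?(negbTE ys).
Qed.

(** Chains are not cut at their last step: the formula follows from [nchains_ups] by induction on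
    the difference of ranks, the double sum over upper covers of [u] and lower covers of [v] being
    symmetric. *)
Lemma nchains_downs u v :
  nchains u v = ((u == v) + \sum_(x <- downs v) nchains u x)%N.
Proof.
have [n] := ubnP (wrank v - wrank u); elim: n u => // n IH u le_n.
have [vu|uv] := ltnP (wrank v) (wrank u).
  rewrite nchains_gt//; have [uv|_] := eqVneq u v;
    first by rewrite uv ltnn in vu.
  rewrite big_seq big1// => x /wrank_downs xv.
  by rewrite nchains_gt// (leq_trans _ vu)// xv.
have [e|/eqP ne] := eqVneq (wrank u) (wrank v).
  rewrite nchains_eq_rank// big_seq big1 ?addn0// => x /wrank_downs xv.
  by rewrite nchains_gt// e xv.
have lt : (wrank u < wrank v)%N by lia.
rewrite nchains_ups; congr addn.
have -> : (\sum_(x <- ups u) nchains x v =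
  \sum_(x <- ups u) (x == v) + \sum_(x <- ups u) \sum_(y <- downs v) nchains x
    y)%N.
  rewrite -big_split /= big_seq [RHS]big_seq; apply: eq_bigr => x /wrank_ups xu.
  by apply: IH; lia.
under [RHS]eq_bigr do rewrite nchains_ups.
rewrite big_split /= exchange_big /=; congr addn.
under eq_bigr do rewrite eq_sym.
by rewrite !sum_pred1 ?ups_uniq ?downs_uniq// mem_downs.
Qed.

(** * Values on the basis [ok_p] *)

Lemma cvgn_sum (R : realType) (I : Type) (s : seq I) (f : nat -> I -> R) (l : I
  -> R) :
  (forall i, f n i @[n --> \oo] --> l i) ->
  \sum_(i <- s) f n i @[n --> \oo] --> \sum_(i <- s) l i.
Proof.
move=> fl; elim: s => [|i s IH].
  by rewrite big_nil; under eq_cvg do rewrite big_nil; exact: cvg_cst.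
by rewrite big_cons; under eq_cvg do rewrite big_cons; exact: cvgD.
Qed.

Section Operators.
Variable R : realType.
Implicit Types (h : fword -> R) (u v w : fword).

Definition Ut h v := \sum_(w <- ups v) h w.
Definition Dt h v := \sum_(w <- downs v) h w.
Definition Yt h v := h (true :: v).

Lemma UtE h v : Ut h v = h (false :: v) + Dt (Yt h) v.
Proof. by rewrite /Ut upsE big_cons big_map. Qed.

Lemma Dt_nil h : Dt h [::] = 0. Proof. exact: big_nil. Qed.
Lemma Dt_one h v : Dt h (false :: v) = h v. Proof. exact: big_seq1. Qed.

Lemma Yt_Dt h : Yt (Dt h) = Ut h. Proof. by []. Qed.

(** The commutation relation of a differential poset. The cover [1v] contributes [h v]; the covers
    [2x] contribute the rest, since [Yt (Dt h)] is [Ut h] by the reflection. *)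
Lemma Ut_Dt h v : Ut (Dt h) v = Dt (Ut h) v + h v.
Proof. by rewrite UtE Dt_one addrC. Qed.

Lemma UtD h h' : Ut (h \+ h') = Ut h \+ Ut h'.
Proof. by apply/funext => v; rewrite /Ut big_split. Qed.

Lemma UtZ a h : Ut (a \*o h) = a \*o Ut h.
Proof. by apply/funext => v; rewrite /Ut /= big_distrr. Qed.

Lemma YtD h h' : Yt (h \+ h') = Yt h \+ Yt h'.
Proof. by []. Qed.

Lemma YtZ a h : Yt (a \*o h) = a \*o Yt h.
Proof. by []. Qed.

Lemma Ut_DtE h : Ut (Dt h) = Dt (Ut h) \+ h.
Proof. by apply/funext => v; exact: Ut_Dt. Qed.

Definition leading (u : fword) := index true u.

(* [pev h u] is the value at [ok_p u] of the linear functional with value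
   [h v] at [ok_s v]: right multiplication by X and Y is dual to [Ut] and
   [Yt]. *)
Fixpoint pev u h : R :=
  match u with
  | [::] => h [::]
  | false :: u' => pev u' (Ut h)
  | true :: u' => pev u' (Ut (Ut h)) - (leading u' + 2)%:R * pev u' (Yt h)
  end.

Lemma pev_two u h : pev (true :: u) h =
  pev u (Ut (Ut h)) - (leading u + 2)%:R * pev u (Yt h).
Proof. by []. Qed.

Lemma pev_Ut u h : pev u (Ut h) = pev (false :: u) h.
Proof. by []. Qed.

Lemma pevD u h h' : pev u (h \+ h') = pev u h + pev u h'.
Proof.
elim: u h h' => [|[] u IH] h h' //=; rewrite !UtD ?(YtD, IH) //.
by ring.
Qed.

Lemma pevZ u a h : pev u (a \*o h) = a * pev u h.
Proof.
elim: u h => [|[] u IH] h //=; rewrite !UtZ ?(YtZ, IH) //.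
by ring.
Qed.

Lemma eq_pev u h h' : (forall v, wrank v = wrank u -> h v = h' v) ->
  pev u h = pev u h'.
Proof.
have eqUt k h1 h2 : (forall v, wrank v = k.+1 -> h1 v = h2 v) ->
    forall v, wrank v = k -> Ut h1 v = Ut h2 v.
  move=> e v vk; rewrite /Ut big_seq [RHS]big_seq;
    apply: eq_bigr => w /wrank_ups.
  by rewrite vk; exact: e.
elim: u h h' => [|[] u IH] h h' hh' /=; first by apply: hh'.
  rewrite (IH (Ut (Ut h)) (Ut (Ut h'))) ?(IH (Yt h) (Yt h'))// => [v|].
    by move=> vu; rewrite /Yt hh'// !wrankE vu.
  apply: (eqUt); apply: (eqUt) => v vu; by rewrite hh'// !wrankE vu.
by apply: IH; apply: eqUt => v vu; rewrite hh'// !wrankE vu.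
Qed.

(** For a leading 2, moving [Dt] past two [Ut] leaves [2 * Ut h], and [Dt] then yields [leading u]
    further copies; the subtracted term [(leading u + 2) * Yt (Dt h)] cancels all of them. *)
Lemma pev_Dt u h : pev u (Dt h) =
  if leading u is m.+1 then m.+1%:R * pev (behead u) h else 0.
Proof.
elim: u h => [|[] u IH] h /=; first by rewrite Dt_nil.
  rewrite !(Ut_DtE, UtD, pevD) Yt_Dt !IH.
  case: u {IH} => [|[] u] //=; rewrite ?mul0r; try ring.
rewrite Ut_DtE pevD IH.
case: u {IH} => [|[] u] //=; rewrite ?add0r ?mul1r//.
by rewrite -[in RHS]natr1 mulrDl mul1r.
Qed.

Lemma pev_iter_Dt j u h : (j <= leading u)%N ->
  pev u (iter j Dt h) = (leading u ^_ j)%:R * pev (drop j u) h.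
Proof.
elim: j u h => [|j IH] u h; first by rewrite drop0 ffactn0 mul1r.
move=> ju; rewrite iterS pev_Dt; case: u ju => [|[] u]//= ju.
by rewrite IH// mulrA -natrM ffactnS.
Qed.

Lemma pev_iter_Dt0 j u h : (leading u < j)%N -> pev u (iter j Dt h) = 0.
Proof.
elim: j u h => [|j IH] u h //.
move=> ju; rewrite iterS pev_Dt; case: u ju => [|[] u]//= ju.
by rewrite IH// mulr0.
Qed.

(** The coefficients may not depend on [h]; hence equality and convergence of the values [pev u h]
    pass to [h] itself. *)
Definition pspan (F : (fword -> R) -> R) : Prop :=
  exists s : seq (R * fword), forall h, F h = \sum_(x <- s) x.1 * pev x.2 h.

Lemma pspanB F G : pspan F -> pspan G -> pspan (fun h => F h - G h).
Proof.
move=> [s Fs] [t Gt]; exists (s ++ [seq (- x.1, x.2) | x <- t]) => h.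
rewrite big_cat big_map /= Fs Gt -sumrN; congr (_ + _).
by apply: eq_bigr => x _; rewrite mulNr.
Qed.

Lemma pspan_Ut F : pspan F -> pspan (F \o Ut).
Proof.
move=> [s Fs]; exists [seq (x.1, false :: x.2) | x <- s] => h.
by rewrite big_map /= Fs.
Qed.

Lemma pspan_Yt F : pspan F -> pspan (F \o Yt).
Proof.
move=> [s Fs].
exists (flatten [seq [:: (x.1 / (leading x.2 + 2)%:R, false :: false :: x.2);
                         (- x.1 / (leading x.2 + 2)%:R, true :: x.2)] | x <-
                           s]) => h.
rewrite big_flatten big_map /= Fs; apply: eq_bigr => -[a u] _.
rewrite big_cons big_seq1 /=.
have : (leading u + 2)%:R != 0 :> R by rewrite pnatr_eq0 addn2.
by move=> ?; field.
Qed.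

(** Evaluation at [1v] is recovered from [UtE] as [Ut h v - Dt (Yt h) v], so the induction must
    treat [Dt] at [v] along with evaluation at [v]. *)
Lemma pspan_eval v : pspan (@^~ v).
Proof.
suff [] : pspan (@^~ v) /\ pspan (Dt^~ v) by [].
elim: v => [|[] v [IH1 IH2]].
- split; first by exists [:: (1, [::])] => h; rewrite big_seq1 mul1r.
  by exists [::] => h; rewrite Dt_nil big_nil.
- split; [exact: (@pspan_Yt (@^~ v))|exact: (@pspan_Ut (@^~ v))].
- split; last first.
    by move: IH1 => [s sE]; exists s => h; rewrite Dt_one.
  have [s sE] := pspanB (pspan_Ut IH1) (pspan_Yt IH2).
  by exists s => h; rewrite -sE /= UtE addrK.
Qed.

Lemma pev_inj h h' : (forall u, pev u h = pev u h') -> h = h'.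
Proof.
move=> hh'; apply/funext => v; have [s sE] := pspan_eval v.
by rewrite sE [RHS]sE; apply: eq_bigr => x _; rewrite hh'.
Qed.

Lemma pev_continuous u (h : nat -> fword -> R) h0 :
  (forall v, h n v @[n --> \oo] --> h0 v) ->
  pev u (h n) @[n --> \oo] --> pev u h0.
Proof.
have cUt (k : nat -> fword -> R) k0 : (forall v, k n v @[n --> \oo] --> k0 v) ->
    forall v, Ut (k n) v @[n --> \oo] --> Ut k0 v.
  by move=> kk v; apply: cvgn_sum.
elim: u h h0 => [|[] u IH] h h0 hh /=; first exact: hh.
  apply: cvgB; first by apply: IH; do 2!apply: (cUt).
  apply: cvgM; first exact: cvg_cst.
  by apply: IH => v; exact: hh.
by apply: IH; apply: cUt.
Qed.

Lemma pev_cvg_eval (h : nat -> fword -> R) (q : fword -> R) :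
  (forall u, pev u (h n) @[n --> \oo] --> q u) ->
  exists2 h0 : fword -> R, forall v, h n v @[n --> \oo] --> h0 v &
    forall u, pev u h0 = q u.
Proof.
move=> hq.
have /choice[h0 h0P] : forall v, exists l : R, h n v @[n --> \oo] --> l.
  move=> v; have [s sE] := pspan_eval v; exists (\sum_(x <- s) x.1 * q x.2).
  under eq_cvg do rewrite sE.
  by apply: cvgn_sum => x; apply: cvgM; [exact: cvg_cst|exact: hq].
exists h0 => // u.
exact: (cvg_unique _ (pev_continuous h0P) (hq u)).
Qed.

Lemma pev_cvg (h : nat -> fword -> R) h0 :
  (forall u, pev u (h n) @[n --> \oo] --> pev u h0) ->
  forall v, h n v @[n --> \oo] --> h0 v.
Proof.
move=> hh v; have [h1 hh1 h10] := pev_cvg_eval hh.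
by have -> : h0 = h1 by apply: pev_inj.
Qed.

Lemma harmonicE h : harmonic h <-> Ut h = h.
Proof.
split=> [hh|hh v]; last by rewrite sum_words_up -[in LHS]hh.
by apply/funext => v; rewrite hh sum_words_up.
Qed.

Lemma pev_harmonic h : (forall u, pev (false :: u) h = pev u h) -> harmonic h.
Proof. by move=> hh; apply/harmonicE; apply: pev_inj => u; rewrite -hh. Qed.

Lemma pev_one h u : harmonic h -> pev (false :: u) h = pev u h.
Proof. by move=> /harmonicE hh; rewrite /= hh. Qed.

End Operators.

(** * Values of the kernels of finite words and of the Plancherel function *)

Section FiniteWords.
Variable R : realType.
Implicit Types (h : fword -> R) (u v w : fword) (g : nat -> R).

(* The factor of [phi_p w u] due to a 2 of [w] at position [d]. *)
Fixpoint fac u (d : nat) : R :=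
  match u with
  | [::] => 1
  | false :: u' => fac u' d
  | true :: u' =>
    if (wrank u' < d)%N then 1 - (wrank u' + 2)%:R / d%:R else fac u' d
  end.

Fixpoint prodf g w : R :=
  match w with
  | [::] => 1
  | false :: w' => prodf g w'
  | true :: w' => g (wrank w').+1 * prodf g w'
  end.

Lemma prodf_two g w : prodf g (true :: w) = g (wrank w).+1 * prodf g w.
Proof. by []. Qed.

Lemma eq_prodf g g' w : (forall d, (0 < d < wrank w)%N -> g d = g' d) ->
  prodf g w = prodf g' w.
Proof.
elim: w => [|[] w IH] //= gg'.
  rewrite gg' ?wrankE ?ltnSn// IH// => d /andP[d0 dw]; apply: gg'.
  by rewrite d0 wrankE; lia.
by apply: IH => d /andP[d0 dw]; apply: gg'; rewrite d0 wrankE; lia.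
Qed.

Definition delta w v : R := (v == w)%:R.

Lemma sum_delta (s : seq fword) w : uniq s ->
  \sum_(x <- s) delta w x = (w \in s)%:R.
Proof.
move=> us; rewrite -sum_pred1// natr_sum.
by apply: eq_bigr => x _; rewrite /delta eq_sym.
Qed.

Lemma Ut_delta_one w : Ut (delta (false :: w)) = delta w.
Proof.
by apply/funext => v; rewrite /Ut sum_delta ?ups_uniq// mem_ups_one.
Qed.

Lemma Ut_delta_two w : Ut (delta (true :: w)) = Dt (delta w).
Proof.
apply/funext => v.
by rewrite /Ut /Dt !sum_delta ?ups_uniq ?downs_uniq// mem_ups_two.
Qed.

Lemma Yt_delta_two w : Yt (delta (true :: w)) = delta w.
Proof. by apply/funext => v; rewrite /Yt /delta eqseq_cons. Qed.

Lemma Yt_delta_one w : Yt (delta (false :: w)) = 0 \*o delta w.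
Proof. by apply/funext => v; rewrite /Yt /delta eqseq_cons /= mul0r. Qed.

(** With [d = |u|] and [u = 1^k 2 u'], the product is [d - (|u'| + 2) = k]. This matches the factor
    produced by [pev_Dt] when a 2 of [w] faces a leading 1 of [u]. *)
Lemma fac_leading u w : wrank u = (wrank w).+1 ->
  (wrank w).+1%:R * fac u (wrank w).+1 = (leading u)%:R.
Proof.
move=> uw; have nz : (wrank w).+1%:R != 0 :> R by rewrite pnatr_eq0.
have aux v k : (k + wrank v = (wrank w).+1)%N ->
    (wrank w).+1%:R * fac v (wrank w).+1 = (k + leading v)%:R.
  elim: v k => [|[] v IH] k /=; rewrite !wrankE => kw.
  - by rewrite mulr1 -kw !addn0.
  - rewrite ifT; last by lia.
    rewrite mulrBr mulr1 mulrCA divff// mulr1 -kw addn0 addnS addnS addn2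
      -!natr1 natrD; ring.
  - by rewrite (IH k.+1) ?addSnnS//; rewrite -kw; lia.
by rewrite (aux u 0%N).
Qed.

Lemma fac_small u d : (d <= wrank u)%N -> fac (true :: u) d = fac u d.
Proof. by rewrite leqNgt => /negbTE /= ->. Qed.

(** The operators strip the first letter of an indicator function: [Ut] sends that of [1w] to that
    of [w] and that of [2w] to [Dt] of that of [w], which [pev_Dt] evaluates. Each of the four cases
    of first letters thus reduces to shorter words. *)
Lemma pev_delta u w : wrank u = wrank w ->
  pev u (delta w) = prodf (fun d => d%:R) w * prodf (fac u) w.
Proof.
elim: w u => [|a w IH] [|b u]; rewrite ?wrank_cons ?wrank_nil//.
  by move=> _ /=; rewrite mulr1 /delta.
case: a b => [] []; rewrite ?(add1n, addSn, add0n) => -[uw].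
- rewrite pev_two !prodf_two [fac _ _]/= uw ltnSn Ut_delta_two Yt_delta_two
    Ut_DtE pevD pev_Dt.
  have -> : prodf (fac (true :: u)) w = prodf (fac u) w.
    by apply: eq_prodf => d /andP[_ /ltnW dw]; rewrite fac_small// uw.
  have -> : (if leading u is m.+1 then m.+1%:R * pev (behead u) (Ut (delta w))
    else 0)
    = (leading u)%:R * pev u (delta w).
    case: u {uw} => [|[] u]; rewrite ?mul0r//.
  rewrite IH//.
  have nz : (wrank w).+1%:R != 0 :> R by rewrite pnatr_eq0.
  (* On the left the coefficient is [leading u + 1 - (leading u + 2) = -1]; on the right, with
     [d = |w| + 1], it is [d * (1 - (d + 1) / d) = -1]. *)
  by rewrite natrD -natr1; field; rewrite addrC natr1.
- rewrite -pev_Ut Ut_delta_two pev_Dt !prodf_two.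
  have := fac_leading uw; case: u uw => [|[] u] /= uw.
  + by rewrite wrank_nil in uw.
  + by move=> fu; rewrite mulrACA fu !mul0r.
  + by move=> fu; rewrite mulrACA fu IH//; move: uw; rewrite wrank_one => -[].
- rewrite pev_two Ut_delta_one Yt_delta_one pevZ mul0r mulr0 subr0 pev_Ut.
  rewrite IH ?wrank_one//; congr (_ * _); apply: eq_prodf => d /andP[_ dw].
  by rewrite fac_small// -ltnS uw.
- by rewrite -pev_Ut Ut_delta_one IH.
Qed.

Lemma sum_nchains_ups v w :
  Ut (fun v => (nchains v w)%:R : R) v = (nchains v w)%:R - delta w v.
Proof. by rewrite [in RHS]nchains_ups natrD natr_sum addrC addKr. Qed.

(** The function [nchains _ w] satisfies the harmonicity equation except at [w]. Hence 1's can be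
    prefixed to [u] without changing the value until the ranks agree, where the function is the
    indicator of [w]; [fac] ignores those 1's. *)
Lemma pev_nchains u w : (wrank u <= wrank w)%N ->
  pev u (fun v => (nchains v w)%:R) = prodf (fun d => d%:R) w * prodf (fac u) w.
Proof.
have [n] := ubnP (wrank w - wrank u); elim: n u => // n IH u len uw.
have [e|ne] := eqVneq (wrank u) (wrank w).
  rewrite -pev_delta//; apply: eq_pev => v vu.
  by rewrite nchains_eq_rank// vu.
rewrite -[RHS](IH (false :: u)) ?wrankE; [|lia|lia].
apply: eq_pev => v vu; rewrite sum_nchains_ups /delta.
have [vw|_] := eqVneq v w; last by rewrite subr0.
by rewrite vw in vu; rewrite vu eqxx in ne.
Qed.

Lemma prodf1 g w : (forall d, g d = 1) -> prodf g w = 1.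
Proof. by move=> g1; elim: w => [|[] w IH] //=; rewrite IH g1 mulr1. Qed.

Lemma dimE w : (dim w)%:R = prodf (fun d => d%:R) w.
Proof.
have := @pev_nchains [::] w; rewrite wrank_nil leq0n => /(_ isT).
by rewrite [prodf (fac _) _]prodf1// mulr1.
Qed.

Lemma dim_gt0 w : (0 < dim w)%N.
Proof.
by rewrite -(ltr0n R) dimE; elim: w => [|[] w IH] //=; rewrite mulr_gt0.
Qed.

Lemma pev_martin_kernel u w : (wrank u <= wrank w)%N ->
  pev u (martin_kernel R w) = prodf (fac u) w.
Proof.
move=> uw; have nz : (dim w)%:R != 0 :> R by rewrite pnatr_eq0 -lt0n dim_gt0.
have -> : martin_kernel R w = (dim w)%:R^-1 \*o (fun v => (nchains v w)%:R).
  by apply/funext => v; rewrite /martin_kernel mulrC.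
by rewrite pevZ pev_nchains// mulrA -dimE mulVf// mul1r.
Qed.

(** The function is harmonic, and [Yt] divides its values at rank [n] by [n + 2]. A leading 2
    therefore gives the factor [1 - (leading u + 2) / (|u| + 2)], which is zero when [u] has only
    1's, the one case where the value at [u] is not zero already. *)
Lemma pev_plancherel u :
  pev u (phi_plancherel R) = (leading u == wrank u)%:R.
Proof.
have YtE v : Yt (phi_plancherel R) v =
    (wrank v + 2)%:R^-1 * phi_plancherel R v.
  rewrite /Yt /phi_plancherel wrank_two dimE /= -dimE !factS addn2 !natrM.
  have := fact_gt0 (wrank v); rewrite -(ltr0n R) => /lt0r_neq0 nz.
  by field; rewrite nz -natrD nat1r !pnatr_eq0.
have UtE : Ut (phi_plancherel R) = phi_plancherel R.
  apply/funext => v; rewrite /Ut /phi_plancherel.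
  transitivity ((\sum_(w <- ups v) (dim w)%:R) / (wrank v).+1`!%:R : R).
    rewrite big_distrl /= big_seq [RHS]big_seq.
    by apply: eq_bigr => w /wrank_ups ->.
  (* The upper covers of [v] are the lower covers of [2v]; by [dimE] the sum is
     [(|v| + 1) * dim v]. *)
  have -> : \sum_(w <- ups v) (dim w)%:R = (dim (true :: v))%:R :> R.
    by rewrite /dim nchains_downs natrD natr_sum add0r.
  rewrite dimE /= -dimE factS natrM.
  have := fact_gt0 (wrank v); rewrite -(ltr0n R) => /lt0r_neq0 nz.
  by field; rewrite nz nat1r pnatr_eq0.
elim: u => [|[] u IH].
- by rewrite /= /phi_plancherel wrank_nil fact0 divr1 dimE.
- rewrite pev_two !UtE.
  have -> : pev u (Yt (phi_plancherel R)) =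
      (wrank u + 2)%:R^-1 * pev u (phi_plancherel R).
    rewrite -pevZ; apply: eq_pev => v vu; by rewrite YtE vu.
  rewrite wrank_two /= IH; case: eqP => [->|_]; last by rewrite !mulr0 subr0.
  by rewrite mulr1 divff ?subrr// pnatr_eq0 addn2.
- by rewrite -pev_Ut UtE IH wrank_one /= eqSS.
Qed.

End FiniteWords.

(** * The effect of the contraction on the values *)

Section Contraction.
Variable R : realType.
Implicit Types (h : fword -> R) (u v w : fword).

Lemma leading_wrank u : (leading u <= wrank u)%N.
Proof. by elim: u => [|[] u IH] //; rewrite wrank_one. Qed.

Lemma sum_words_nchains k h v : (k <= wrank v)%N ->
  \sum_(u <- words k) h u * (nchains u v)%:R = iter (wrank v - k) (@Dt R) h v.
Proof.
move Dn : (wrank v - k)%N => n; elim: n v Dn => [|n IH] v vn vk.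
  have vkE : wrank v = k by apply/eqP; rewrite eqn_leq vk -subn_eq0 vn.
  rewrite (bigD1_seq v) /= ?words_uniq//; last by rewrite mem_words vkE.
  rewrite nchains_eq_rank// eqxx mulr1 big_seq_cond big1 ?addr0// => u /andP[].
  rewrite mem_words => /eqP uk /negbTE uv.
  by rewrite nchains_eq_rank ?uk// uv mulr0.
transitivity (\sum_(u <- words k) \sum_(x <- downs v) h u * (nchains u x)%:R).
  rewrite big_seq [RHS]big_seq; apply: eq_bigr => u;
    rewrite mem_words => /eqP uk.
  rewrite nchains_downs; have [uv|_] := eqVneq u v; first by rewrite uv in uk;
    lia.
  by rewrite add0n natr_sum big_distrr.
rewrite exchange_big /= /Dt big_seq [RHS]big_seq;
  apply: eq_bigr => x /wrank_downs xv.
by apply: IH; lia.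
Qed.

Lemma pev_sum (I : Type) (s : seq I) (c : I -> R) (F : I -> fword -> R) u :
  pev u (fun v => \sum_(k <- s) c k * F k v) = \sum_(k <- s) c k * pev u (F k).
Proof.
elim: s => [|k s IH].
  rewrite big_nil -[RHS](mul0r (pev u (fun=> 0))) -pevZ; apply: eq_pev => v _.
  by rewrite big_nil /= mul0r.
rewrite big_cons -IH -pevZ -pevD; apply: eq_pev => v _.
by rewrite big_cons.
Qed.

Lemma pev_drop_harmonic u h j : harmonic h -> (j <= leading u)%N ->
  pev (drop j u) h = pev u h.
Proof.
move=> hh; elim: j u => [|j IH] [|[] u]//= ju;
  first by rewrite IH// (pev_Ut u) pev_one.
Qed.

Lemma pev_iter_Dt_harmonic u h j : harmonic h ->
  pev u (iter j (@Dt R) h) = (leading u ^_ j)%:R * pev u h.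
Proof.
move=> hh; have [ju|uj] := leqP j (leading u).
  by rewrite pev_iter_Dt// pev_drop_harmonic.
by rewrite pev_iter_Dt0// ffact_small// mul0r.
Qed.

(** The inner sum over words of rank [k] is the iterate [Dt^(n-k) h], whose value is a falling
    factorial of [m = leading u] times that of [h]. Divided by [(n-k)!] this is a binomial
    coefficient, and the sum is [beta^(n-m) * (beta + (1 - beta))^m]. *)
Lemma pev_contraction beta h u : harmonic h ->
  pev u (contraction beta h) = beta ^+ (wrank u - leading u) * pev u h.
Proof.
move=> hh; set n := wrank u; set m := leading u.
have mn : (m <= n)%N := leading_wrank u.
pose c k := beta ^+ k * (1 - beta) ^+ (n - k) / (n - k)`!%:R.
transitivity (pev u (fun v => \sum_(k <- index_iota 0 n.+1)
    c k * iter (n - k) (@Dt R) h v)).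
  apply: eq_pev => v vn; rewrite /contraction vn -/n.
  apply: eq_big_nat => k /andP[_ kn]; rewrite sum_words_nchains vn -/n//.
rewrite pev_sum; under eq_bigr do rewrite pev_iter_Dt_harmonic// mulrA.
rewrite -big_distrl /= -/m; congr (_ * _).
rewrite big_mkord (reindex_inj rev_ord_inj) /=.
transitivity (\sum_(j < n.+1) beta ^+ (n - m) *
   (if (j < m.+1)%N then (beta ^+ (m - j) * (1 - beta) ^+ j) *+ 'C(m, j) else
     0)).
  apply: eq_bigr => j _; rewrite subSS; have jn := ltn_ord j.
  rewrite /c subKn//; case: ltnP => jm; last by rewrite ffact_small// !mulr0.
  rewrite -bin_ffact natrM -mulr_natr.
  have := fact_gt0 j; rewrite -(ltr0n R) => /lt0r_neq0 nz.
  rewrite (_ : beta ^+ (n - j) = beta ^+ (n - m) * beta ^+ (m - j));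
    first by field.
  by rewrite -exprD; congr (_ ^+ _); lia.
rewrite -big_distrr /= -[RHS]mulr1 -[in RHS](expr1n _ m); congr (_ * _).
rewrite -[in RHS](subrKC beta 1) exprDn -big_mkcond /=.
by rewrite -(big_ord_widen _ (fun j => (beta ^+ (m - j) * (1 - beta) ^+ j) *+
  'C(m, j))).
Qed.
End Contraction.

(** * The Okada ring *)

Lemma big_perm_lift (V : nmodType) n (F : 'S_n.+1 -> V) :
  \sum_(s : 'S_n.+1) F s =
  \sum_(i < n.+1) \sum_(s : 'S_n) F (lift_perm ord_max i s).
Proof.
rewrite pair_big /=; apply: reindex.
pose f (x : 'I_n.+1 * 'S_n) := lift_perm ord_max x.1 x.2.
suff : bijective f by exact: onW_bij.
apply: inj_card_bij; last by rewrite card_prod !card_Sn card_ord factS.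
move=> [i s] [j t]; rewrite /f /= => st.
have ij : i = j by rewrite -(lift_perm_id ord_max i s) st lift_perm_id.
rewrite -{}ij in st *; congr pair; apply/permP => k; apply: (@lift_inj _ i).
by rewrite -!(lift_perm_lift ord_max) st.
Qed.

Lemma runs_leading v : runs v = leading v :: behead (runs v).
Proof. by elim: v => [|[] v IH] //=; rewrite IH. Qed.

Section ColumnDeterminant.
Variable S : nzRingType.

Definition coldet n (A : 'M[S]_n) : S :=
  \sum_(s : 'S_n) (-1) ^+ s * \prod_(j < n) A (s j) j.

(** The products run in the order of the columns, so the entry of the last column can be split off
    on the right without commuting anything. *)
Lemma coldet_expand n (B : 'M[S]_n.+1) :
  coldet B = \sum_(i < n.+1)
    (-1) ^+ (n + i) * coldet (row' i (col' ord_max B)) * B i ord_max.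
Proof.
rewrite /coldet big_perm_lift; apply: eq_bigr => i _.
rewrite big_distrr big_distrl /=; apply: eq_bigr => s _.
rewrite big_ord_recr /= lift_perm_id !mulrA; congr (_ * _); congr (_ * _).
  by rewrite odd_lift_perm -[in RHS](signr_odd _ (n + i)) -signr_addb oddD.
apply: eq_bigr => j _; rewrite !mxE -(lift_perm_lift ord_max).
by congr (B (lift_perm _ _ _ _) _); apply/val_inj; rewrite [RHS]lift_max.
Qed.

Lemma coldet_row0 n (B : 'M[S]_n) i : (forall j, B i j = 0) -> coldet B = 0.
Proof.
move=> Bi0; rewrite /coldet big1// => s _.
have [r1 [r2 ->]] : exists r1 r2, index_enum 'I_n = r1 ++ (s^-1)%g i :: r2.
  have : (s^-1)%g i \in index_enum 'I_n by rewrite mem_index_enum.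
  by case/splitPr => r1 r2; exists r1, r2.
by rewrite big_cat big_cons /= permKV Bi0 mul0r !mulr0.
Qed.

Definition nd (A : nat -> nat -> S) n : S :=
  coldet (\matrix_(i < n, j < n) A i j).

Lemma nd0 A : nd A 0 = 1.
Proof.
rewrite /nd /coldet (big_pred1 1%g) => [|s]; last first.
  by apply/esym/eqP/permP => -[].
by rewrite odd_perm1 expr0 big_ord0 mulr1.
Qed.

Lemma nd1 A : nd A 1 = A 0 0.
Proof.
rewrite /nd coldet_expand big_ord1 !mxE /= expr0 mul1r.
have -> : coldet (row' ord0 (col' ord_max (\matrix_(i < 1, j < 1) A i j))) = 1.
  rewrite -[RHS](nd0 A); congr coldet; apply/matrixP => -[]//.
by rewrite mul1r.
Qed.

Lemma nd_tridiagonal A n :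
  (forall i, (i < n)%N -> A i n.+1 = 0) ->
  (forall j, (j < n)%N -> A n.+1 j = 0) ->
  nd A n.+2 = nd A n.+1 * A n.+1 n.+1 - nd A n * A n.+1 n * A n n.+1.
Proof.
have bumpS m k : (k < m)%N -> bump m k = k by move=> km;
  rewrite /bump leqNgt km.
move=> col0 row0; rewrite /nd coldet_expand big_ord_recr big_ord_recr /=.
rewrite big1 ?add0r => [|i _]; last by rewrite !mxE /= col0 ?mulr0.
rewrite !mxE /= addrC; congr (_ + _).
  rewrite -signr_odd addnn odd_double mul1r; congr (coldet _ * _).
  by apply/matrixP => i j; rewrite !mxE /= !bumpS.
rewrite -signr_odd addSn oddS addnn odd_double expr1 !mulN1r !mulNr.
congr (- (_ * _)).
rewrite coldet_expand big_ord_recr /= big1 ?add0r => [|i _].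
  rewrite !mxE /= -signr_odd addnn odd_double mul1r /bump leqnn ltnn add1n.
  congr (coldet _ * _); apply/matrixP => i j; rewrite !mxE /= !bumpS//.
  by rewrite ltnS ltnW.
(* Both deleted rows lie above row [n.+1], which is therefore row [n.-1] of this minor, and it is
   zero in the first [n] columns. *)
have n0 : (n.-1 < n)%N by have := ltn_ord i; lia.
rewrite (@coldet_row0 _ _ (Ordinal n0)) ?mulr0 ?mul0r// => j.
rewrite !mxE /= (bumpS n j)// (bumpS n.+1 j) ?ltnS ?(ltnW (ltn_ord j))//.
have -> : bump i n.-1 = n by rewrite /bump; have := ltn_ord i; lia.
by rewrite /bump leqnn add1n row0.
Qed.

Variables X Y : S.

Definition Pent (i j : nat) : S :=
  if i == j then X else if j == i.+1 then Y else if i == j.+1 then 1 else 0.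

Definition Qent (i j : nat) : S :=
  match i with
  | 0%N => if (j <= 1)%N then Y else 0
  | 1%N => if (j <= 1)%N then X else if j == 2%N then Y else 0
  | _ => Pent i j
  end.

Lemma Pent_diag i : Pent i i = X. Proof. by rewrite /Pent eqxx. Qed.
Lemma Pent_sup i : Pent i i.+1 = Y.
Proof. by rewrite /Pent eqxx ltn_eqF. Qed.
Lemma Pent_sub i : Pent i.+1 i = 1.
Proof. by rewrite /Pent eqxx gtn_eqF// ltn_eqF// ltnS ltnW. Qed.
Lemma Pent_col0 i n : (i < n)%N -> Pent i n.+1 = 0.
Proof. by move=> lt_in; rewrite /Pent !ifF//; apply/negbTE; lia. Qed.
Lemma Pent_row0 n j : (j < n)%N -> Pent n.+1 j = 0.
Proof. by move=> lt_jn; rewrite /Pent !ifF//; apply/negbTE; lia. Qed.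

Lemma nd_PentSS n : nd Pent n.+2 = nd Pent n.+1 * X - nd Pent n * Y.
Proof.
rewrite (nd_tridiagonal (fun i => @Pent_col0 i n) (@Pent_row0 n)).
by rewrite Pent_diag Pent_sub Pent_sup mulr1.
Qed.

Lemma nd_Qent2 : nd Qent 2 = Y * X - X * Y.
Proof. by rewrite nd_tridiagonal// nd0 nd1 mul1r. Qed.

Lemma nd_QentSSS n : nd Qent n.+3 = nd Qent n.+2 * X - nd Qent n.+1 * Y.
Proof.
rewrite nd_tridiagonal; first last.
- by move=> j; exact: Pent_row0.
- move=> [|[|i]] lt_in //=; last exact: Pent_col0.
  by case: n lt_in.
- rewrite [Qent n.+2 n.+2]Pent_diag [Qent n.+2 n.+1]Pent_sub mulr1.
  by case: n => [|n] //; rewrite [Qent n.+2 n.+3]Pent_sup.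
Qed.

Definition run_prod (P Q : nat -> S) v : S :=
  P (run v 0) * \prod_(1 <= i < (ntwos v).+1) Q (run v i).

Fixpoint run_fold (P Q : nat -> S) (r : seq nat) : S :=
  match r with
  | [::] => 1
  | [:: k] => P k
  | k :: r' => run_fold P Q r' * Q k
  end.

Lemma run_foldE P Q v : run_prod P Q v = run_fold P Q (runs v).
Proof.
rewrite /run_prod /run; have : size (runs v) = (ntwos v).+1.
  by elim: v => [|[] v IH] //=; [rewrite IH|case: (runs v) IH].
elim: (ntwos v) (runs v) => [|n IH] [|k [|k' r]]//.
  by move=> _; rewrite big_geq// mulr1.
move=> [sz]; rewrite big_nat_recr// mulrA -[RHS]/(run_fold P Q (k' :: r) * Q k).
rewrite -IH ?[size _]/= ?sz//; congr (_ * _ * Q _).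
- by rewrite rev_cons nth_rcons size_rev.
- apply: eq_big_nat => i /andP[_ lt_i]; rewrite (rev_cons k) nth_rcons size_rev.
  by rewrite /= sz lt_i.
- by rewrite rev_cons nth_rcons size_rev /= sz ltnn eqxx.
Qed.

Definition s_elt := run_prod (nd Pent) (fun n => nd Qent n.+1).

Lemma s_elt_nil : s_elt [::] = 1.
Proof. by rewrite /s_elt run_foldE /= nd0. Qed.

Lemma s_elt_two v : s_elt (true :: v) = s_elt v * Y.
Proof.
by rewrite /s_elt !run_foldE [runs (true :: v)]/= runs_leading /= nd1.
Qed.

(** The Pieri rule. Before a 2 it comes from [Q_1 = Y X - X Y], which gives the word [12v] and
    leaves [s_v X Y] to the induction; before a 1 it is the three-term recursion, the same for [P]
    and [Q]. *)
Lemma mulrX_s_elt v : s_elt v * X = \sum_(w <- ups v) s_elt w.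
Proof.
elim: v => [|[] v IH]; rewrite upsE big_cons big_map.
- rewrite big_nil addr0 s_elt_nil mul1r /s_elt run_foldE /=.
  by rewrite nd1 Pent_diag.
- under eq_bigr do rewrite s_elt_two.
  rewrite -big_distrl /= -[\sum_(_ <- _) _]IH.
  have -> : s_elt (false :: true :: v) = s_elt v * (Y * X - X * Y).
    by rewrite /s_elt !run_foldE -nd_Qent2 [runs (_ :: _)]/= runs_leading.
  by rewrite s_elt_two mulrBr !mulrA subrK.
- rewrite big_seq1 s_elt_two /s_elt !run_foldE /= runs_leading /=.
  case: (behead (runs v)) => [|k r] /=; first by rewrite nd_PentSS subrK.
  by rewrite nd_QentSSS mulrBr !mulrA subrK.
Qed.

Definition p_elt v : S :=
  (\prod_(0 <= i < ntwos v)
     (X ^+ (run v i + 2)%N - (run v i + 2)%:R * X ^+ run v i * Y))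
  * X ^+ run v (ntwos v).

Lemma size_runs v : size (runs v) = (ntwos v).+1.
Proof. by elim: v => [|[] v IH] //=; [rewrite IH|case: (runs v) IH]. Qed.

Lemma run_ntwos v : run v (ntwos v) = leading v.
Proof.
by rewrite /run nth_rev size_runs// subnn runs_leading.
Qed.

Lemma run_cons (a : bool) v i : (i < ntwos v + a)%N -> run (a :: v) i = run v i.
Proof.
move=> lt_i; rewrite /run; have := size_runs v; case: a lt_i => /= lt_i sz;
  rewrite ?addn1 ?addn0 in lt_i.
  by rewrite rev_cons nth_rcons size_rev sz lt_i.
case: (runs v) sz => //= k r [sz].
by rewrite !rev_cons !nth_rcons size_rev sz lt_i.
Qed.

Lemma p_elt_nil : p_elt [::] = 1.
Proof. by rewrite /p_elt big_geq// mul1r. Qed.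

Lemma p_elt_one v : p_elt (false :: v) = p_elt v * X.
Proof.
rewrite /p_elt run_ntwos [leading _]/= -/(leading v) run_ntwos exprSr mulrA.
congr (_ * _ * _); apply: eq_big_nat => i /andP[_ lt_i].
by rewrite run_cons// addn0.
Qed.

Lemma p_elt_two v : p_elt (true :: v) =
  p_elt v * X * X - (p_elt v * Y) *+ (leading v + 2).
Proof.
rewrite /p_elt run_ntwos [leading _]/= mulr1 [ntwos _]/= big_nat_recr//=.
rewrite run_cons ?addn1// run_ntwos -mulrnAr -!mulrA -!mulrBr; congr (_ * _).
  by apply: eq_big_nat => i /andP[_ lt_i]; rewrite run_cons// addn1 ltnW.
by rewrite mulrBr addn2 !exprSr !mulrA mulr_natl mulrnAl mulrnAr.
Qed.

End ColumnDeterminant.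

Lemma ok_sE : ok_s = @s_elt okada okX okY. Proof. by []. Qed.
Lemma ok_pE : ok_p = @p_elt okada okX okY. Proof. by []. Qed.

(** * Functionals on the Okada ring with prescribed values *)

Section Functionals.
Variable R : realType.
Implicit Types (f : okada -> R) (h : fword -> R).

Section RatLinear.
Variable f : okada -> R.
Hypothesis fL : rat_linear f.

Lemma rat_linear0 : f 0 = 0.
Proof.
have := fL 1 0 0; rewrite scale1r addr0 rmorph1 mul1r => /eqP.
by rewrite -subr_eq subrr => /eqP.
Qed.

Lemma rat_linearD x y : f (x + y) = f x + f y.
Proof. by rewrite -[x in LHS]scale1r fL rmorph1 mul1r. Qed.

Lemma rat_linearZ a x : f (a *: x) = ratr a * f x.
Proof. by rewrite -[_ *: _]addr0 fL rat_linear0 addr0. Qed.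

Lemma rat_linearMn x n : f (x *+ n) = n%:R * f x.
Proof. by rewrite -scaler_nat rat_linearZ ratr_nat. Qed.

Lemma rat_linearB x y : f (x - y) = f x - f y.
Proof. by rewrite -scaleN1r rat_linearD rat_linearZ rmorphN rmorph1 mulN1r. Qed.

Lemma rat_linear_sum (I : Type) (s : seq I) (F : I -> okada) :
  f (\sum_(i <- s) F i) = \sum_(i <- s) f (F i).
Proof.
elim: s => [|i s IH]; first by rewrite !big_nil rat_linear0.
by rewrite !big_cons rat_linearD IH.
Qed.

Lemma rat_linear_mulr z : rat_linear (fun x => f (x * z)).
Proof. by move=> a x y; rewrite mulrDl -scalerAl fL. Qed.

End RatLinear.

Lemma rat_linear_p f u : rat_linear f -> f (ok_p u) = pev u (f \o ok_s).
Proof.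
have Ux (g : okada -> R) : rat_linear g -> (fun x => g (x * okX)) \o ok_s = Ut
  (g \o ok_s).
  move=> gL; apply/funext => v /=.
  by rewrite ok_sE mulrX_s_elt (rat_linear_sum gL).
elim: u f => [|[] u IH] f fL.
- by rewrite /= ok_pE p_elt_nil ok_sE s_elt_nil.
- have fX := rat_linear_mulr fL okX.
  have eXX := IH _ (rat_linear_mulr fX okX);
    have eY := IH _ (rat_linear_mulr fL okY).
  rewrite ok_pE p_elt_two -ok_pE (rat_linearB fL) (rat_linearMn fL) pev_two.
  transitivity (pev u (Ut (Ut (f \o ok_s))) -
      (leading u + 2)%:R * pev u ((fun x => f (x * okY)) \o ok_s)).
    congr (_ - _ * _); last exact: eY.
    have UX1 := Ux f fL; have UX2 := Ux _ fX.
    rewrite -UX1 -UX2. exact: eXX.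
  congr (_ - _ * pev _ _).
  by apply/funext => v; rewrite /Yt /= ok_sE s_elt_two.
- have eX := IH _ (rat_linear_mulr fL okX).
  rewrite ok_pE p_elt_one -ok_pE -pev_Ut.
  have UX1 := Ux f fL; rewrite -UX1. exact: eX.
Qed.

Fixpoint mon_eval (m : seq bool) h : R :=
  match m with
  | [::] => h [::]
  | false :: m' => mon_eval m' (Ut h)
  | true :: m' => mon_eval m' (Yt h)
  end.

(** A functional with value [h v] at [ok_s v], prescribed on monomials. The last letter of a
    monomial acts on [h] first, whence [rev]. *)
Definition extend_linear h (x : okada) : R :=
  monalg.mmap (ratr : rat -> R) (fun m : monalg.fmonom bool => mon_eval (rev m)
    h) x.

Lemma extend_linear_rat h : rat_linear (extend_linear h).
Proof.
move=> a x y; rewrite /extend_linear mmapD; congr (_ + _).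
rewrite (mmapEw (msuppZ_le _ _)) mmapE big_distrr /=.
apply: eq_bigr => k _; rewrite mcoeffZ rmorphM; exact: esym (mulrA _ _ _).
Qed.

Lemma extend_linear_mul h x i : extend_linear h (x * (@monalg.mkmalgU
  (monalg.fmonom bool) rat (monalg.fmu i) 1 : okada)) =
  extend_linear (if i then Yt h else Ut h) x.
Proof.
rewrite malgM_def fgmulgU (rat_linear_sum (extend_linear_rat h)).
rewrite [RHS]mmapE; apply: eq_bigr => k _.
rewrite /extend_linear mmapU mulr1; congr (_ * _).
have -> : rev (mmul k (monalg.fmu i)) = i :: rev k.
  by rewrite (fmM k) fmU rev_cat.
by case: i.
Qed.

Lemma extend_linear_X h x : extend_linear h (x * okX) = extend_linear (Ut h) x.
Proof. exact: extend_linear_mul false. Qed.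

Lemma extend_linear_Y h x : extend_linear h (x * okY) = extend_linear (Yt h) x.
Proof. exact: extend_linear_mul true. Qed.

Lemma extend_linear1 h : extend_linear h 1 = h [::].
Proof. rewrite /extend_linear mmapU /= fm1;
  have -> : ratr (1 : rat) = 1 :> R by exact: rmorph1. by rewrite mul1r. Qed.

Lemma extend_linear_s h v : extend_linear h (ok_s v) = h v.
Proof.
have [n] := ubnP (wrank v); elim: n h v => // n IH h [|[] v].
- by rewrite ok_sE s_elt_nil extend_linear1.
- rewrite wrank_two => lt_v; rewrite ok_sE s_elt_two -ok_sE.
  by rewrite extend_linear_Y IH//; lia.
- rewrite wrank_one => lt_v.
  have -> : ok_s (false :: v) = ok_s v * okX - \sum_(u <- downs v) ok_s u * okY.
    rewrite ok_sE mulrX_s_elt upsE big_cons big_map.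
    by under eq_bigr do rewrite s_elt_two; rewrite addrK.
  have eL := extend_linear_rat h.
  rewrite (rat_linearB eL) extend_linear_X IH; last by lia.
  rewrite (rat_linear_sum eL).
  apply/eqP; rewrite subr_eq UtE; apply/eqP; congr (_ + _).
  rewrite /Dt big_seq [RHS]big_seq; apply: eq_bigr => u /wrank_downs uv.
  by rewrite extend_linear_Y IH//; lia.
Qed.

(** [extend_linear h0] shows that the set given to [xget] is inhabited; the functional selected has
    the prescribed values, and [rat_linear_p] reads them as [pev]. *)
Lemma pev_phi_word w h0 : (forall u, pev u h0 = phi_p R w u) ->
  forall u, pev u (phi_word R w) = phi_p R w u.
Proof.
move=> h0E u.
have : [set f | rat_linear f /\ forall u, f (ok_p u) = phi_p R w u] !=set0.
  exists (extend_linear h0); split; first exact: extend_linear_rat.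
  move=> u'; rewrite rat_linear_p; last exact: extend_linear_rat.
  by rewrite -h0E; congr pev; apply/funext => v /=; exact: extend_linear_s.
by move=> /(xgetPex (fun=> 0))[fL <-]; rewrite rat_linear_p.
Qed.

End Functionals.

(** * Products over the 2's of an infinite word *)

Section InfiniteProducts.
Variable R : realType.
Implicit Types (g : nat -> R) (w : infword) (u : fword).

Lemma letter_posS w l : letter_pos w l.+1 = (letter_pos w l + (w l).+1)%N.
Proof. by rewrite /letter_pos big_ord_recr. Qed.

Lemma letter_pos_gt w l : (l < letter_pos w l)%N.
Proof. by elim: l => [|l IH] //; rewrite letter_posS; lia. Qed.

Lemma eq_letter_pos w w' N : (forall i, (i < N)%N -> w i = w' i) ->
  letter_pos w N = letter_pos w' N.
Proof.
by move=> ww'; rewrite /letter_pos; congr S; apply: eq_bigr => i _; rewrite ww'.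
Qed.

Definition iprod g w N : R := \prod_(l < N | w l) g (letter_pos w l).

Lemma iprod0 g w : iprod g w 0 = 1. Proof. exact: big_ord0. Qed.

Lemma iprodS g w N :
  iprod g w N.+1 = iprod g w N * (if w N then g (letter_pos w N) else 1).
Proof.
rewrite /iprod big_mkcond big_ord_recr -big_mkcond /=.
by case: ifP => //; rewrite mulr1.
Qed.

Lemma eq_iprod g w w' N : (forall i, (i < N)%N -> w i = w' i) ->
  iprod g w N = iprod g w' N.
Proof.
elim: N => [|N IH] ww'; first by rewrite !iprod0.
rewrite !iprodS IH => [|i iN]; last by apply: ww'; rewrite ltnS ltnW.
by rewrite ww'// (@eq_letter_pos w w') // => i iN; apply: ww';
  rewrite ltnS ltnW.
Qed.

Lemma eq_iprod_fun g g' w N : g =1 g' -> iprod g w N = iprod g' w N.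
Proof. by move=> gg'; apply: eq_bigr => l _; rewrite gg'. Qed.

Lemma iprodM g g' w N : iprod (fun d => g d * g' d) w N = iprod g w N * iprod
  g' w N.
Proof. exact: big_split. Qed.

Lemma iprodX g w N k : iprod (fun d => g d ^+ k) w N = iprod g w N ^+ k.
Proof. by rewrite /iprod prodrXl. Qed.

(** Positions exceed indices, so from index [D] on the products of factors are nonincreasing and
    nonnegative. The first [D] factors, of any sign, form a constant. *)
Lemma cvg_iprod g w D : (forall d, (D <= d)%N -> 0 <= g d <= 1) -> cvgn (iprod
  g w).
Proof.
move=> g01; pose x k := if w (k + D)%N then g (letter_pos w (k + D)) else 1.
have x01 k : 0 <= x k <= 1.
  rewrite /x; case: ifP => _; last by rewrite ler01 lexx.
  by apply: g01; have := letter_pos_gt w (k + D); lia.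
pose q k := \prod_(i < k) x i.
have qS k : q k.+1 = q k * x k by rewrite /q big_ord_recr.
have q0 k : 0 <= q k by apply: prodr_ge0 => i _; have /andP[] := x01 i.
have : cvgn q.
  apply: nonincreasing_is_cvgn; last by exists 0 => _ [k _ <-].
  apply/nonincreasing_seqP => k; rewrite qS ler_piMr//.
  by have /andP[] := x01 k.
move=> /cvg_ex[/= l ql]; apply/cvg_ex; exists (iprod g w D * l).
rewrite -(cvg_shiftn D) /=.
have -> : (fun n => iprod g w (n + D)) = (fun n => iprod g w D * q n).
  apply/funext; elim => [|k IH]; first by rewrite add0n /q big_ord0 mulr1.
  by rewrite addSn iprodS IH qS mulrA.
by apply: cvgM; [exact: cvg_cst|].
Qed.

(* The bound makes the infinite products converge uniformly in the word. *)
Definition tame g (D : nat) (C : R) :=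
  forall d, (D <= d)%N -> 0 < g d <= 1 /\ 1 - g d <= C / d%:R ^+ 2.

Lemma tame_cvg g w D C : tame g D C -> cvgn (iprod g w).
Proof.
by move=> tg; apply: (@cvg_iprod g w D) => d /tg[/andP[/ltW -> ->]].
Qed.

Lemma iprod_tail g w D C M N : 0 <= C -> tame g D C ->
    (D <= M)%N -> (0 < M)%N -> (M <= N)%N ->
  exists t, [/\ 0 <= t <= 1, 1 - t <= C / M%:R & iprod g w N = iprod g w M * t].
Proof.
move=> C0 tg DM M0 MN.
(* A position beyond index [n] satisfies [d^2 >= n * (n + 1)], so the losses telescope; this sharper
   bound is what the induction carries. *)
suff [t [t01 tC tE]] : exists t, [/\ 0 <= t <= 1, 1 - t <= C * (M%:R^-1 -
  N%:R^-1) &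
    iprod g w N = iprod g w M * t].
  exists t; split=> //; apply: le_trans tC _; rewrite ler_wpM2l// gerBl.
  by rewrite invr_ge0.
rewrite -(subnK MN); elim: (N - M)%N => [|k [t [/andP[t0 t1] tC tE]]].
  by exists 1; rewrite add0n mulr1 !subrr mulr0 ler01 !lexx.
set n := (k + M)%N in t0 t1 tC tE *.
have n0 : (0 < n)%N by rewrite /n addn_gt0 M0 orbT.
pose x := if w n then g (letter_pos w n) else 1.
have nx : 0 <= x <= 1 /\ 1 - x <= C * (n%:R^-1 - n.+1%:R^-1).
  have n0' : 0 < n%:R :> R by rewrite ltr0n.
  have nS : (n%:R^-1 - n.+1%:R^-1) = (n%:R * n.+1%:R)^-1 :> R.
    by field; rewrite ?nat1r !pnatr_eq0 -?lt0n ?n0.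
  have R0 : 0 <= n%:R^-1 - n.+1%:R^-1 :> R by rewrite nS invr_ge0 mulr_ge0.
  rewrite /x; case: ifP => _; last by rewrite subrr ler01 lexx mulr_ge0.
  have lp := letter_pos_gt w n.
  have [|/andP[/ltW-> ->] gC] := tg (letter_pos w n); first by lia.
  split=> //; apply: le_trans gC _; rewrite ler_wpM2l// nS lef_pV2 ?posrE.
  - by rewrite -natrX -natrM ler_nat; nia.
  - by rewrite exprn_gt0// ltr0n; lia.
  - by rewrite mulr_gt0.
case: nx => /andP[x0 x1] xC; exists (t * x); split.
- by rewrite mulr_ge0//= mulr_ile1.
- rewrite addSn -/n.
  have -> : C * (M%:R^-1 - n.+1%:R^-1) =
     C * (M%:R^-1 - n%:R^-1) + C * (n%:R^-1 - n.+1%:R^-1) by ring.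
  apply: le_trans (lerD tC xC).
  rewrite -subr_ge0 (_ : _ - _ = (1 - t) * (1 - x)); last by ring.
  by rewrite mulr_ge0 ?subr_ge0.
- by rewrite addSn iprodS -/n tE mulrA.
Qed.

Lemma limn_iprod_dist g w D C M : 0 <= C -> tame g D C -> (D <= M)%N -> (0 <
  M)%N ->
  `|limn (iprod g w) - iprod g w M| <= `|iprod g w M| * (C / M%:R).
Proof.
move=> C0 tg DM M0.
have cl : `|iprod g w n - iprod g w M| @[n --> \oo] --> `|limn (iprod g w) -
  iprod g w M|.
  apply: cvg_norm; apply: cvgB; last exact: cvg_cst.
  exact: tame_cvg tg.
apply: (ler_cvg_to cl (cvg_cst _)).
exists M => // N /= MN;
  have [t [/andP[t0 t1] tC ->]] := iprod_tail w C0 tg DM M0 MN.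
rewrite -[X in _ * t - X]mulr1 -mulrBr normrM ler_wpM2l// distrC ger0_norm//.
by rewrite subr_ge0.
Qed.

Lemma iprod_bound g w D C M : 0 <= C -> tame g D C -> (D <= M)%N ->
  `|iprod g w M| <= `|iprod g w D|.
Proof.
move=> C0 tg DM; rewrite -(subnK DM); elim: (M - D)%N => [|k IH]//.
rewrite addSn iprodS normrM; apply: le_trans IH; rewrite ler_piMr//.
case: ifP => _; last by rewrite normr1.
have [|/andP[g0 g1] _] := tg (letter_pos w (k + D)).
  by have := letter_pos_gt w (k + D); lia.
by rewrite ger0_norm// ltW.
Qed.

Lemma limn_iprod_gt0 g w D C : 0 <= C -> tame g D C ->
  (forall l, w l -> 0 < g (letter_pos w l)) -> 0 < limn (iprod g w).
Proof.
move=> C0 tg g0; have ip N : 0 < iprod g w N by apply: prodr_gt0 => l /g0.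
(* With [C / M <= 1/2] the limit is at least half of the partial product at [M]. *)
pose M := maxn D (Num.truncn (C * 2)).+1.
have M0 : (0 < M)%N by rewrite leq_max orbT.
have := limn_iprod_dist w C0 tg (leq_maxl _ _ : (D <= M)%N) M0.
have CM : C / M%:R <= 2^-1.
  rewrite ler_pdivrMr ?ltr0n// ler_pdivlMl//  mulrC.
  apply: le_trans (ltW (truncnS_gt _)) _.
  by rewrite ler_nat leq_maxr.
have := ip M; rewrite ler_norml (gtr0_norm (ip M)) => p0 /andP[+ _].
rewrite lerBrDr; apply: lt_le_trans.
have : iprod g w M * (C / M%:R) <= iprod g w M * 2^-1 by rewrite ler_pM2l.
by lra.
Qed.

Lemma limn_iprod_continuous g D C (x : nat -> infword) w : 0 <= C -> tame g D C
  ->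
  (forall i, \forall n \near \oo, x n i = w i) ->
  limn (iprod g (x n)) @[n --> \oo] --> limn (iprod g w).
Proof.
move=> C0 tg xw; apply/cvgrPdist_le => e e0.
pose B := `|iprod g w D|.
(* Beyond [M] the tails change either product by at most [e / 2], and words with the same first [M]
   digits have the same partial product. *)
pose M := maxn D (Num.truncn (B * C / (e / 2))).+1.
have M0 : (0 < M)%N by rewrite leq_max orbT.
have DM : (D <= M)%N := leq_maxl _ _.
have : \forall n \near \oo, forall i, (i < M)%N -> x n i = w i.
  elim: M {M0 DM} => [|M IH]; first by apply: nearW.
  near=> n => i; rewrite ltnS leq_eqVlt => /orP[/eqP->|].
    by near: n; exact: xw.
  by move: i; near: n; exact: IH.
apply: filterS => n xn.
have xM := eq_iprod g xn.
have h1 := limn_iprod_dist w C0 tg DM M0;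
  have h2 := limn_iprod_dist (x n) C0 tg DM M0.
have Be : `|iprod g w M| * (C / M%:R) <= e / 2.
  apply: le_trans (_ : B * (C / M%:R) <= _).
    by rewrite ler_wpM2r ?divr_ge0// (iprod_bound _ C0 tg).
  rewrite mulrA ler_pdivrMr ?ltr0n// [leRHS]mulrC -ler_pdivrMr ?divr_gt0//.
  apply: le_trans (ltW (truncnS_gt _)) _.
  by rewrite ler_nat leq_maxr.
rewrite xM in h2; rewrite (splitr e);
  apply: le_trans (lerD (le_trans h1 Be) (le_trans h2 Be)).
rewrite -[X in X <= _](_ : `|(limn (iprod g w) - iprod g w M) -
   (limn (iprod g (x n)) - iprod g w M)| = _); first exact: ler_normB.
by congr (`|_|); ring.
Unshelve. all: by end_near. Qed.

End InfiniteProducts.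

Lemma cvgn_exp (R : realType) (x : nat -> R) (l : R) k :
  x n @[n --> \oo] --> l -> x n ^+ k @[n --> \oo] --> l ^+ k.
Proof.
move=> xl; elim: k => [|k IH]; first exact: cvg_cst.
by under eq_cvg do rewrite exprS; rewrite exprS; exact: cvgM.
Qed.

Lemma cvgn_prod (R : realType) (I : Type) (s : seq I) (f : nat -> I -> R) (l :
  I -> R) :
  (forall i, f n i @[n --> \oo] --> l i) ->
  \prod_(i <- s) f n i @[n --> \oo] --> \prod_(i <- s) l i.
Proof.
move=> fl; elim: s => [|i s IH].
  by rewrite big_nil; under eq_cvg do rewrite big_nil; exact: cvg_cst.
by rewrite big_cons; under eq_cvg do rewrite big_cons; exact: cvgM.
Qed.

(** * Splitting off the power of pi *)

Section BoundaryValues.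
Variable R : realType.
Implicit Types (g : nat -> R) (w : infword) (u : fword).
Local Notation fac := (@fac R).

Definition stripped u := (wrank u - leading u)%N.

Lemma stripped_one u : stripped (false :: u) = stripped u.
Proof. by rewrite /stripped wrank_one. Qed.

Lemma stripped_two u : stripped (true :: u) = (wrank u).+2.
Proof. by rewrite /stripped wrank_two. Qed.

Lemma fac_large u d : (stripped u < d)%N -> fac u d = 1 - (stripped u)%:R /
  d%:R.
Proof.
elim: u => [|[] u IH].
- by rewrite /stripped wrank_nil /= mul0r subr0.
- by rewrite stripped_two /= addn2 => ud; rewrite ifT//; lia.
- by rewrite stripped_one.
Qed.

(** The value 1 at position 1, where [1 - 1/d] vanishes, agrees with the definition of pi and allows
    division. *)
Definition pifac (d : nat) : R := if (2 <= d)%N then 1 - d%:R^-1 else 1.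

Lemma pifac_gt0 d : 0 < pifac d.
Proof.
rewrite /pifac; case: ifP => // d2; rewrite subr_gt0 invf_lt1 ?ltr1n//.
by rewrite ltr0n; lia.
Qed.

Lemma pifac_ge0 d : 0 <= pifac d. Proof. exact/ltW/pifac_gt0. Qed.

Lemma pifac_le1 d : pifac d <= 1.
Proof. by rewrite /pifac; case: ifP => // _; rewrite gerBl invr_ge0. Qed.

(* The quotient is 1 - O(1/d^2). *)
Definition gfac u d : R := fac u d / pifac d ^+ stripped u.

Lemma facE u d : fac u d = gfac u d * pifac d ^+ stripped u.
Proof. by rewrite /gfac divfK// expf_neq0// gt_eqF// pifac_gt0. Qed.

Lemma bernoulli_bounds (x : R) k : 0 <= x <= 1 ->
  1 - k%:R * x <= (1 - x) ^+ k <= 1 - k%:R * x + (k%:R * x) ^+ 2.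
Proof.
move=> /andP[x0 x1]; elim: k => [|k /andP[IH1 IH2]].
  by rewrite mul0r subr0 expr0 expr0n addr0 lexx.
have k0 : 0 <= k%:R :> R by [].
rewrite exprS -natr1; apply/andP; split.
  apply: le_trans (_ : (1 - x) * (1 - k%:R * x) <= _); last first.
    by rewrite ler_wpM2l// subr_ge0.
  by have := mulr_ge0 k0 (mulr_ge0 x0 x0); nra.
apply: le_trans (_ : (1 - x) * (1 - k%:R * x + (k%:R * x) ^+ 2) <= _).
  by rewrite ler_wpM2l// subr_ge0.
have xk : 0 <= x * (k%:R * x) ^+ 2 by rewrite mulr_ge0// sqr_ge0.
have kx : 0 <= k%:R * (x * x) by rewrite !mulr_ge0.
have xx : 0 <= x * x by rewrite mulr_ge0.
rewrite -subr_ge0 (_ : _ - _ = x * (k%:R * x) ^+ 2 + k%:R * (x * x) + x * x);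
  last by ring.
by rewrite !addr_ge0.
Qed.

Lemma tame_gfac u : exists2 D, (0 < D)%N & exists2 C, 0 <= C & tame (gfac u) D
  C.
Proof.
(* From here on [fac u d] is [1 - r/d], and [(1 - 1/d)^r] exceeds it by at most [(r/d)^2]. Dividing
   by this power, which is at least [1 - r/d >= 1/(r+1)], costs the factor [r.+1] of the
   constant. *)
set r := stripped u; exists r.+2 => //.
exists (r%:R ^+ 2 * r.+1%:R); first by rewrite mulr_ge0// exprn_ge0.
move=> d rd; have d2 : (2 <= d)%N by lia.
have d0 : 0 < d%:R :> R by rewrite ltr0n; lia.
rewrite /gfac fac_large; last by rewrite -/r; lia.
have x01 : 0 <= (d%:R^-1 : R) <= 1.
  by rewrite invr_ge0 ltW//= invf_le1// ler1n; lia.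
rewrite /pifac d2 -/r; have /andP[b1 b2] := bernoulli_bounds r x01.
have n0 : r.+1%:R^-1 <= 1 - r%:R / d%:R :> R.
  rewrite -subr_ge0 (_ : _ - _ = r%:R / r.+1%:R - r%:R / d%:R); last first.
    by rewrite -natr1; field; rewrite (gt_eqF d0)/= natr1 pnatr_eq0.
  rewrite subr_ge0 ler_wpM2l// lef_pV2 ?posrE ?ltr0n// ?ler_nat; lia.
have r0 : 0 < r.+1%:R^-1 :> R by rewrite invr_gt0 ltr0n.
set y := _ ^+ r in b1 b2 *.
have y0 : 0 < y by apply: lt_le_trans b1; apply: lt_le_trans n0.
split.
  by rewrite divr_gt0 ?(lt_le_trans r0 n0)// ler_pdivrMr// mul1r.
rewrite -[X in X - _](divff (lt0r_neq0 y0)) -mulrBl ler_pdivrMr//.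
apply: le_trans (_ : (r%:R * d%:R^-1) ^+ 2 <= _); first by lra.
rewrite [leRHS](_ : _ = (r%:R / d%:R) ^+ 2 * (r.+1%:R * y)); last first.
  by rewrite exprMn exprVn; ring.
rewrite ler_peMr ?sqr_ge0//.
rewrite -ler_pdivrMl ?ltr0n// mulr1.
by apply: le_trans b1.
Qed.

Definition Jprod u w : R := limn (iprod (gfac u) w).

Lemma Jprod_cvg u w : iprod (gfac u) w N @[N --> \oo] --> Jprod u w.
Proof. by have [D _ [C _ tg]] := tame_gfac u; exact: tame_cvg tg. Qed.

Lemma piwE w : piw R w = limn (iprod pifac w).
Proof.
rewrite /piw; congr (limn _); apply/funext => N.
by rewrite /iprod big_mkcondr.
Qed.

Lemma piw_cvg w : iprod pifac w N @[N --> \oo] --> piw R w.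
Proof.
rewrite piwE; apply: (@cvg_iprod _ _ _ 0) => d _.
by rewrite pifac_le1 ltW// pifac_gt0.
Qed.

Lemma iprod_fac u w N :
  iprod (fac u) w N = iprod (gfac u) w N * iprod pifac w N ^+ stripped u.
Proof.
by rewrite -iprodX -iprodM; apply: eq_iprod_fun => d; rewrite facE.
Qed.

Lemma iprod_fac_cvg u w :
  iprod (fac u) w N @[N --> \oo] --> Jprod u w * piw R w ^+ stripped u.
Proof.
under eq_cvg do rewrite iprod_fac.
by apply: cvgM; [exact: Jprod_cvg|apply: cvgn_exp; exact: piw_cvg].
Qed.

Lemma Jprod_continuous u (x : nat -> infword) w :
  (forall i, \forall n \near \oo, x n i = w i) ->
  Jprod u (x n) @[n --> \oo] --> Jprod u w.
Proof.
by move=> xw; have [D _ [C C0 tg]] := tame_gfac u;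
  exact: limn_iprod_continuous tg xw.
Qed.

Lemma Jprod_one u w : Jprod (false :: u) w = Jprod u w.
Proof.
rewrite /Jprod; congr (limn _); apply/funext => N; apply: eq_iprod_fun => d.
by rewrite /gfac stripped_one.
Qed.

Lemma Jprod_nil w : Jprod [::] w = 1.
Proof.
apply: cvg_lim => //; have -> : iprod (gfac [::]) w = cst 1;
  last exact: cvg_cst.
apply/funext => N; rewrite /iprod big1// => l _.
by rewrite /gfac /stripped wrank_nil /= divr1.
Qed.

Definition block u i d : R :=
  let delta := nth 0%N (twos u) in
  if (delta i <= d)%N && ((i.+1 < size (twos u))%N ==> (d < delta i.+1)%N)
  then 1 - (delta i).+1%:R / d%:R else 1.

Lemma twos_le u i : (nth 0 (twos u) i <= wrank u)%N.
Proof.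
elim: u => [|[] u IH] /=; first by rewrite nth_nil.
  rewrite wrank_two nth_rcons; case: ifP => _;
    first by rewrite (leq_trans IH)//; lia.
  by case: ifP.
by rewrite wrank_one ltnW.
Qed.

(** The blocks are disjoint half-open ranges, so at most one factor differs from 1: that of the
    leftmost 2 of [u] at a position at most [d], where the recursion of [fac] stops. *)
Lemma prod_block u d : \prod_(i < size (twos u)) block u i d = fac u d.
Proof.
elim: u => [|[] u IH] /=; first by rewrite big_ord0.
  rewrite size_rcons big_ord_recr /=.
  have last : block (true :: u) (size (twos u)) d =
      if (wrank u < d)%N then 1 - (wrank u + 2)%:R / d%:R else 1.
    by rewrite /block /= size_rcons ltnn nth_rcons ltnn eqxx andbT addn2.
  rewrite last; case: ltnP => ud.
    rewrite big1 ?mul1r// => i _; rewrite /block /= size_rcons ltnS ltn_ord /=.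
    rewrite ifF//; apply/negbTE; rewrite negb_and -!leqNgt !nth_rcons;
      apply/orP; right.
    case: ifP => [_|/negbT]; first by rewrite (leq_trans (twos_le _ _))// ltnW.
    by rewrite -leqNgt => si; rewrite ifT//; have := ltn_ord i; lia.
  rewrite mulr1 -IH; apply: eq_bigr => i _;
    rewrite /block /= size_rcons ltnS ltn_ord /=.
  rewrite !nth_rcons ltn_ord; congr (if _ && _ then _ else _).
  case: (ltnP i.+1 (size (twos u))) => si //=; rewrite ifT ?ltnS//.
  by have := ltn_ord i; lia.
by rewrite -IH.
Qed.

Lemma phi_p_blockE w u i : phi_p_block R w u i = limn (iprod (block u i) w).
Proof.
rewrite /phi_p_block; congr (limn _); apply/funext => N.
by rewrite /iprod big_mkcondr.
Qed.

Lemma cvg_block w u i : cvgn (iprod (block u i) w).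
Proof.
apply: (@cvg_iprod _ _ _ (nth 0 (twos u) i).+1) => d ud.
rewrite /block; case: ifP => _; last by rewrite ler01 lexx.
rewrite subr_ge0 gerBl divr_ge0// ler_pdivrMr ?mul1r ?ler_nat ?ud//.
by rewrite ltr0n; lia.
Qed.

Lemma phi_pE w u : phi_p R w u = Jprod u w * piw R w ^+ stripped u.
Proof.
suff cP : iprod (fac u) w N @[N --> \oo] --> phi_p R w u.
  exact: (cvg_unique _ cP (@iprod_fac_cvg u w)).
have facE' N : iprod (fac u) w N = \prod_(i < size (twos u)) iprod (block u i)
  w N.
  rewrite /iprod exchange_big; apply: eq_bigr => l _ /=.
  by rewrite prod_block.
under eq_cvg do rewrite facE'.
apply: cvgn_prod => i; rewrite phi_p_blockE; exact: cvg_block.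
Qed.

End BoundaryValues.

(** * Finite words as infinite words, and the values of the limit functions *)

Section PaddedWords.
Variable R : realType.
Implicit Types (g : nat -> R) (w x : infword) (u v : fword).
Local Notation fac := (@fac R).

(** Padding on the left by 1's, which contribute no factor to the products. *)
Definition pad v : infword := nth false (rev v).

Definition trunc w N : fword := rev (mkseq w N).

Lemma pad_trunc w N i : (i < N)%N -> pad (trunc w N) i = w i.
Proof. by move=> iN; rewrite /pad revK nth_mkseq. Qed.

Lemma size_wrank v : (size v <= wrank v)%N.
Proof. by elim: v => [|[] v IH] //;
  rewrite ?wrank_one ?wrank_two//= ltnS ltnW. Qed.

Lemma size_trunc w N : size (trunc w N) = N.
Proof. by rewrite size_rev size_mkseq. Qed.

Lemma pad_cons (a : bool) v i : (i < size v)%N -> pad (a :: v) i = pad v i.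
Proof. by move=> iv; rewrite /pad rev_cons nth_rcons size_rev iv. Qed.

Lemma pad_cons_size (a : bool) v : pad (a :: v) (size v) = a.
Proof. by rewrite /pad rev_cons nth_rcons size_rev ltnn eqxx. Qed.

Lemma iprod_eventually g w M N : (forall i, (M <= i)%N -> w i = false) ->
  (M <= N)%N -> iprod g w N = iprod g w M.
Proof.
move=> w0 MN; rewrite -(subnK MN); elim: (N - M)%N => [|k IH]//.
by rewrite addSn iprodS IH w0 ?leq_addl// mulr1.
Qed.

Lemma letter_pos_pad v : letter_pos (pad v) (size v) = (wrank v).+1.
Proof.
elim: v => [|a v IH]; first by rewrite /letter_pos big_ord0 wrank_nil.
rewrite letter_posS pad_cons_size (@eq_letter_pos _ (pad v)) => [|i];
  last exact: pad_cons.
by rewrite IH wrank_cons addSn addnC.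
Qed.

Lemma iprod_pad_size g v : iprod g (pad v) (size v) = prodf g v.
Proof.
elim: v => [|a v IH]; first by rewrite iprod0.
rewrite /= iprodS pad_cons_size (@eq_iprod _ _ _ (pad v)) => [|i];
  last exact: pad_cons.
rewrite IH (@eq_letter_pos _ (pad v)) => [|i]; last exact: pad_cons.
by rewrite letter_pos_pad; case: a; rewrite ?mulr1// mulrC.
Qed.

Lemma iprod_pad g v N : (size v <= N)%N -> iprod g (pad v) N = prodf g v.
Proof.
move=> vN; rewrite (@iprod_eventually _ _ (size v))// ?iprod_pad_size// => i vi.
by rewrite /pad nth_default// size_rev.
Qed.

Lemma limn_iprod_pad g v : iprod g (pad v) N @[N --> \oo] --> prodf g v.
Proof.
apply: cvg_near_cst; exists (size v) => // N /= vN.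
by rewrite iprod_pad.
Qed.

(** Puts kernels and limit functions in one family: a kernel corresponds to the pair of digits
    [pad v] and [t = piw R (pad v)]. *)
Lemma pev_martin_kernel_pad u v : (wrank u <= wrank v)%N ->
  pev u (martin_kernel R v) = Jprod R u (pad v) * piw R (pad v) ^+ stripped u.
Proof.
move=> uv; rewrite pev_martin_kernel//.
exact: (cvg_unique _ (@limn_iprod_pad (fac u) v) (@iprod_fac_cvg R u (pad v))).
Qed.

(** The function required by [pev_phi_word] is the pointwise limit of the kernels of the truncations
    of [w], whose values are the partial products. *)
Lemma pev_phi_wordE u w :
  pev u (phi_word R w) = Jprod R u w * piw R w ^+ stripped u.
Proof.
have [|h0 _ h0E] := @pev_cvg_eval R (fun N => martin_kernel R (trunc w N))
  (phi_p R w).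
  move=> u'; rewrite phi_pE; apply: cvg_trans (@iprod_fac_cvg R u' w).
  apply: near_eq_cvg; exists (wrank u') => // N /= uN.
  rewrite pev_martin_kernel; last first.
    by apply: leq_trans uN _;
      rewrite -[X in (X <= _)%N](size_trunc w) size_wrank.
  rewrite -iprod_pad_size size_trunc; apply: eq_iprod => i iN.
  by rewrite pad_trunc.
by rewrite (pev_phi_word h0E) phi_pE.
Qed.

Lemma harmonic_phi_word w : harmonic (phi_word R w).
Proof.
by apply: pev_harmonic => u; rewrite !pev_phi_wordE Jprod_one stripped_one.
Qed.

Lemma Jprod_stripped0 u w : stripped u = 0%N -> Jprod R u w = 1.
Proof.
elim: u => [|[] u IH]; first by rewrite Jprod_nil.
  by rewrite stripped_two.
by rewrite stripped_one Jprod_one.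
Qed.

(* By [pev_phi_Omega] below, [phi_Omega o] depends only on the digits of [o]
   and on [om_tau o], and not on the digits when [om_tau o = 0]. *)
Definition om_tau (o : Omega R) : R :=
  if o is Some x then om_beta x * piw R (om_word x) else 0.

Definition om_digits (o : Omega R) : infword :=
  if o is Some x then om_word x else fun=> false.

Lemma pev_phi_Omega u (o : Omega R) :
  pev u (phi_Omega o) = Jprod R u (om_digits o) * om_tau o ^+ stripped u.
Proof.
case: o => [x|] /=.
  rewrite pev_contraction; last exact: harmonic_phi_word.
  by rewrite pev_phi_wordE exprMn -/(stripped u) mulrCA.
(* At P the formula relies on [0 ^+ 0 = 1]: the value is 1 exactly when [u] consists of 1's. *)
rewrite pev_plancherel expr0n /stripped subn_eq0.
have [lw|lw] := eqVneq (leading u) (wrank u).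
  by rewrite lw leqnn mulr1 Jprod_stripped0// /stripped lw subnn.
by rewrite leqNgt ltn_neqAle lw leading_wrank mulr0.
Qed.

Lemma iprod_pifac_gt0 w N : 0 < iprod (pifac R) w N.
Proof. by apply: prodr_gt0 => l _; exact: pifac_gt0. Qed.

Lemma iprod_pifac_nonincreasing w : nonincreasing_seq (iprod (pifac R) w).
Proof.
apply/nonincreasing_seqP => N;
  rewrite iprodS ler_piMr ?(ltW (iprod_pifac_gt0 _ _))//.
by case: ifP => // _; exact: pifac_le1.
Qed.

Lemma piw_le_iprod w N : piw R w <= iprod (pifac R) w N.
Proof.
rewrite piwE; apply: nonincreasing_cvgn_ge.
  exact: iprod_pifac_nonincreasing.
by apply/cvg_ex; exists (piw R w); exact: piw_cvg.
Qed.

Lemma summable_piw_gt0 w : summable_word R w -> 0 < piw R w.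
Proof.
move=> sw; pose s N : R := \sum_(l < N | w l) (letter_pos w l)%:R^-1.
have cs : cvgn s := sw.
have sS N : s N.+1 = s N + (if w N then (letter_pos w N)%:R^-1 else 0).
  rewrite /s big_mkcond big_ord_recr -big_mkcond /=.
  by case: ifP.
have ns : nondecreasing_seq s.
  by apply/nondecreasing_seqP => N; rewrite sS lerDl; case: ifP.
have [M _ sM] : \forall N \near \oo, limn s - 2^-1 < s N.
  have /cvgrPdist_lt/(_ 2^-1) := cs.
  rewrite invr_gt0 ltr0n => /(_ isT); apply: filterS => N.
  by rewrite ltr_norml => /andP[_]; rewrite ltrBlDr ltrBlDl addrC.
have sle N : s N <= limn s by apply: nondecreasing_cvgn_le.
set m := M.+1.
(* A product of factors [1 - y] is at least 1 minus the sum of the [y], here a tail sum below 1/2.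
   As [m > 0], the positions concerned are at least 2. *)
have key N : iprod (pifac R) w m * (1 - (s (N + m)%N - s m)) <= iprod (pifac R)
  w (N + m).
  elim: N => [|N IH]; first by rewrite add0n subrr subr0 mulr1.
  rewrite addSn iprodS sS; set n := (N + m)%N.
  case: ifP => wn; last by rewrite addr0 mulr1.
  have lp := letter_pos_gt w n.
  rewrite /pifac ifT; last by rewrite /n /m in lp *; lia.
  set y := _^-1; have y01 : 0 <= y <= 1.
    by rewrite invr_ge0 ler0n invf_le1 ?ler1n ?ltr0n//; lia.
  have /andP[y0 y1] := y01.
  apply: le_trans (_ : iprod (pifac R) w m * (1 - (s n - s m)) * (1 - y) <= _).
    rewrite -mulrA ler_pM2l ?iprod_pifac_gt0//.
    have : 0 <= s n - s m by rewrite subr_ge0; apply: ns; rewrite leq_addl.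
    by nra.
  by rewrite ler_wpM2r// subr_ge0.
have : iprod (pifac R) w m * 2^-1 <= piw R w.
  rewrite piwE; apply: limr_ge.
    by apply/cvg_ex; exists (piw R w); exact: piw_cvg.
  exists m => // N /= mN; rewrite -(subnK mN); apply: le_trans (key _).
  rewrite ler_pM2l ?iprod_pifac_gt0//.
  have := sM m (leqnSn M); have := sle (N - m + m)%N; rewrite /=.
  by lra.
by apply: lt_le_trans; rewrite mulr_gt0 ?iprod_pifac_gt0// invr_gt0.
Qed.

Lemma piw_gt0_summable w : 0 < piw R w -> summable_word R w.
Proof.
move=> p0; pose s N : R := \sum_(l < N | w l) (letter_pos w l)%:R^-1.
have sS N : s N.+1 = s N + (if w N then (letter_pos w N)%:R^-1 else 0).
  rewrite /s big_mkcond big_ord_recr -big_mkcond /=.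
  by case: ifP.
have ns : nondecreasing_seq s.
  by apply/nondecreasing_seqP => N; rewrite sS lerDl; case: ifP.
have s1 : s 1 = (w 0)%:R.
  by rewrite sS /s big_ord0 add0r /letter_pos big_ord0 invr1; case: (w 0).
(* Inductive step: [(A + y) * (1 - y) <= A] for [A >= 1]. A 2 at position 1 has factor 1 in the
   product and is taken out of the sum. *)
have key N : (1 + (s N.+1 - (w 0)%:R)) * iprod (pifac R) w N.+1 <= 1.
  elim: N => [|N IH].
    rewrite s1 subrr addr0 mul1r;
      apply: le_trans (_ : iprod (pifac R) w 0 <= _).
      exact: iprod_pifac_nonincreasing.
    by rewrite iprod0.
  rewrite sS iprodS; case: ifP => wn; last by rewrite addr0 mulr1.
  have lp := letter_pos_gt w N.+1.
  rewrite [pifac R _]/pifac ifT; last by lia.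
  set y := _^-1; have y01 : 0 <= y <= 1.
    by rewrite invr_ge0 ler0n invf_le1 ?ler1n ?ltr0n//; lia.
  have /andP[y0 y1] := y01; apply: le_trans IH.
  rewrite mulrCA [leRHS]mulrC ler_pM2l ?iprod_pifac_gt0//.
  have : 0 <= s N.+1 - (w 0)%:R by rewrite subr_ge0 -s1; apply: ns.
  by nra.
apply: (@nondecreasing_is_cvgn R s) => //; exists (piw R w)^-1 => _ [N _ <-].
apply: le_trans (ns _ _ (leqnSn N)) _.
have p := iprod_pifac_gt0 w N.+1.
apply: le_trans (_ : (iprod (pifac R) w N.+1)^-1 <= _); last first.
  by rewrite lef_pV2 ?posrE// piw_le_iprod.
rewrite -[leRHS]mul1r ler_pdivlMr//; apply: le_trans (key N).
rewrite ler_wpM2r ?(ltW p)//.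
by case: (w 0) => /=; lra.
Qed.

End PaddedWords.

(** * Injectivity *)

Section Injectivity.
Variable R : realType.
Implicit Types (g : nat -> R) (w : infword).

Definition single_two k : fword := true :: nseq k false.

Lemma wrank_nseq1 k : wrank (nseq k false) = k.
Proof. by elim: k => [|k IH]; rewrite /= ?wrank_nil// wrank_one IH. Qed.

Lemma stripped_single k : stripped (single_two k) = k.+2.
Proof. by rewrite stripped_two wrank_nseq1. Qed.

Lemma fac_single k d : fac R (single_two k) d =
  if (k < d)%N then 1 - k.+2%:R / d%:R else 1.
Proof.
rewrite /= wrank_nseq1 addn2; case: ifP => // _.
by elim: k => [|k IH].
Qed.

Lemma fac_single_eq0 k d : (fac R (single_two k) d == 0) = (d == k.+2).
Proof.
rewrite fac_single; case: ltnP => kd; last first.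
  by rewrite oner_eq0; apply/esym/negbTE; lia.
have d0 : d%:R != 0 :> R by rewrite pnatr_eq0; lia.
rewrite subr_eq0 -(inj_eq (mulIf d0)) mul1r divfK// eqr_nat.
by [].
Qed.

Lemma gfac_single_eq0 k d : (gfac R (single_two k) d == 0) = (d == k.+2).
Proof.
rewrite /gfac mulf_eq0 invr_eq0 fac_single_eq0 expf_eq0.
by rewrite (gt_eqF (pifac_gt0 R d)) andbF orbF.
Qed.

Lemma letter_pos_homo w : {homo letter_pos w : i j / (i < j)%N}.
Proof.
by apply: homo_ltn => [i j k|i]; [exact: ltn_trans|rewrite letter_posS; lia].
Qed.

Lemma letter_pos_inj w : injective (letter_pos w).
Proof.
move=> i j ij; case: (ltngtP i j) => // /(letter_pos_homo w);
  by rewrite ij ltnn.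
Qed.

Definition two_at w p : Prop := exists2 l, w l & letter_pos w l = p.

Lemma iprod_normr g w N : iprod (fun d => `|g d|) w N = `|iprod g w N|.
Proof. by rewrite /iprod normr_prod. Qed.

Lemma normr_Jprod_gt0 u w :
  (forall l, w l -> gfac R u (letter_pos w l) != 0) ->
  0 < limn (iprod (fun d => `|gfac R u d|) w).
Proof.
move=> g0; have [D _ [C C0 tg]] := tame_gfac R u.
apply: (@limn_iprod_gt0 _ _ _ D C) => // [d /tg[/andP[g0' g1] gC]|l /g0].
  by rewrite gtr0_norm// g0'.
by rewrite normr_gt0.
Qed.

(** The product of the absolute values is tame, so it can vanish only through a factor, and the only
    zero of [fac] for this word is at [k.+2]. *)
Lemma Jprod_single_eq0 k w : Jprod R (single_two k) w = 0 <-> two_at w k.+2.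
Proof.
split=> [J0|[l wl lk]]; last first.
  apply: (@cvg_lim R) => //; apply: cvg_near_cst; exists l.+1 => // N /= lN.
  rewrite /iprod (bigD1 (Ordinal lN))//= lk.
  have /eqP -> : gfac R (single_two k) k.+2 == 0 by rewrite gfac_single_eq0.
  by rewrite mul0r.
apply: contrapT => nk.
have := @normr_Jprod_gt0 (single_two k) w.
have -> : limn (iprod (fun d => `|gfac R (single_two k) d|) w) = 0.
  apply: cvg_lim => //; rewrite -[0 in X in _ --> X](normr0 R) -J0.
  by under eq_cvg do rewrite iprod_normr; apply: cvg_norm; exact: Jprod_cvg.
rewrite ltxx => h; suff : false by []; apply: h => l wl.
by rewrite gfac_single_eq0; apply/eqP => lk; apply: nk; exists l.
Qed.

(** Zeros detect only positions from 2 on; position 1 is seen by the sign. The factor [1 - 2/d] is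
    negative only at [d = 1], and a 2 there excludes one at position 2, so no other factor
    vanishes. *)
Lemma Jprod_single0_lt0 w : (Jprod R (single_two 0) w < 0) = w 0.
Proof.
apply/idP/idP => [|w0].
  apply: contraTT => w0; rewrite -leNgt.
  apply: limr_ge; first by apply/cvg_ex; eexists; exact: Jprod_cvg.
  apply: nearW => N; apply: prodr_ge0 => l wl.
  rewrite /gfac divr_ge0 ?exprn_ge0 ?pifac_ge0//.
  rewrite fac_single (leq_ltn_trans _ (letter_pos_gt w l))//.
  have l0 : (0 < l)%N by case: (val l) wl => // w0'; rewrite w0' in w0.
  have lp := letter_pos_gt w l.
  by rewrite subr_ge0 ler_pdivrMr ?ltr0n ?mul1r ?ler_nat; lia.
have E N : iprod (gfac R (single_two 0)) w N.+1 =
    - iprod (fun d => `|gfac R (single_two 0) d|) w N.+1.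
  elim: N => [|N IH].
    rewrite !iprodS !iprod0 w0 !mul1r ler0_norm ?opprK//.
    rewrite /gfac /letter_pos big_ord0 fac_single /= /pifac /= expr1n divr1.
    lra.
  rewrite iprodS IH [in RHS]iprodS mulNr; congr (- (_ * _)).
  case: ifP => // wN; rewrite ger0_norm//.
  rewrite /gfac divr_ge0 ?exprn_ge0 ?pifac_ge0//.
  have lp := letter_pos_gt w N.+1.
  rewrite fac_single (leq_ltn_trans _ lp)//.
  by rewrite subr_ge0 ler_pdivrMr ?ltr0n ?mul1r ?ler_nat; lia.
have g0 l : w l -> gfac R (single_two 0) (letter_pos w l) != 0.
  move=> wl; rewrite gfac_single_eq0; case: l wl => [|l] wl.
    by rewrite /letter_pos big_ord0.
  have : (letter_pos w 1 <= letter_pos w l.+1)%N.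
    by case: l {wl} => // l; apply/ltnW/letter_pos_homo.
  by rewrite letter_posS w0 /letter_pos big_ord0 => lp; apply/negP => /eqP e;
    rewrite e in lp.
have := normr_Jprod_gt0 g0; rewrite -oppr_lt0; congr (_ < 0).
apply/esym/cvg_lim => //; rewrite -(cvg_shiftS (iprod _ _)) /=.
under eq_cvg do rewrite E.
apply: cvgN; rewrite (cvg_shiftS (iprod _ _)).
by have [D _ [C C0 tg]] := tame_gfac R (single_two 0);
  apply: (@tame_cvg _ _ _ D C) => d /tg[/andP[g0' g1] gC];
    rewrite gtr0_norm// g0'.
Qed.

(** A 2 takes up two units of rank, so 2's cannot stand at both positions 2 and 3. *)
Lemma Jprod_single_neq0 w : exists k, Jprod R (single_two k) w <> 0.
Proof.
apply: contrapT => /forallNP J0.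
have J k : Jprod R (single_two k) w = 0 by apply: contrapT; exact: J0.
have /Jprod_single_eq0[l wl l2] := J 0%N.
have /Jprod_single_eq0[m wm m3] := J 1%N.
have [lm|ml|lm] := ltngtP l m.
- have : (letter_pos w l.+1 <= letter_pos w m)%N.
    by move: lm; rewrite leq_eqVlt => /orP[/eqP->//|/(letter_pos_homo w)/ltnW].
  by rewrite letter_posS l2 m3 wl.
- by have := letter_pos_homo w ml; rewrite l2 m3.
- by move: m3; rewrite -lm l2.
Qed.

Lemma om_tau_ge0 (o : Omega R) : 0 <= om_tau o.
Proof.
case: o => //= x; have /andP[/ltW b0 _] := om_beta_itv x.
by rewrite mulr_ge0//; have /andP[] := piw_itv R (om_word x).
Qed.

Lemma om_tau_gt0 (x : om_point R) : 0 < om_tau (Some x).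
Proof.
have /andP[b0 _] := om_beta_itv x; rewrite /= mulr_gt0//.
exact: summable_piw_gt0 (@om_word_summable _ x).
Qed.

Lemma om_tau_le (o : Omega R) : om_tau o <= piw R (om_digits o).
Proof.
case: o => [x|] /=; last by have /andP[] := piw_itv R (fun=> false).
have /andP[_ b1] := om_beta_itv x; rewrite ler_piMl//.
by have /andP[] := piw_itv R (om_word x).
Qed.

Lemma om_point_eq (x y : om_point R) : om_word x = om_word y ->
  om_tau (Some x) = om_tau (Some y) -> x = y.
Proof.
case: x y => [b w b01 sw] [b' w' b01' sw'] /= ww'; case: w' / ww' sw' => sw'.
have p0 := summable_piw_gt0 sw.
move/(mulIf (lt0r_neq0 p0)) => bb'; case: b' / bb' b01' => b01'.
by rewrite (Prop_irrelevance sw sw') (bool_irrelevance b01 b01').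
Qed.

Lemma phi_Omega_inj : injective (@phi_Omega R).
Proof.
move=> o o' oo'.
have E k : Jprod R (single_two k) (om_digits o) * om_tau o ^+ k.+2 =
    Jprod R (single_two k) (om_digits o') * om_tau o' ^+ k.+2.
  by rewrite -(stripped_single k) -!pev_phi_Omega oo'.
have tau_neq0 o1 o2 : (forall k,
    Jprod R (single_two k) (om_digits o1) * om_tau o1 ^+ k.+2 =
    Jprod R (single_two k) (om_digits o2) * om_tau o2 ^+ k.+2) ->
    om_tau o1 = 0 -> om_tau o2 = 0.
  move=> E12 t0; have [k /eqP Jk] := Jprod_single_neq0 (om_digits o2).
  have /esym/eqP := E12 k; rewrite t0 expr0n mulr0 mulf_eq0 (negbTE Jk) /=.
  by rewrite expf_eq0 => /eqP.
case: o o' oo' E => [x|] [y|] oo' E //; last 2 first.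
- by have /eqP := tau_neq0 None (Some x) (fun k => esym (E k)) erefl;
    rewrite gt_eqF// om_tau_gt0.
- by have /eqP := tau_neq0 _ (Some y) E erefl; rewrite gt_eqF// om_tau_gt0.
have tx := om_tau_gt0 x; have ty := om_tau_gt0 y.
set w := om_digits (Some x) in E *; set w' := om_digits (Some y) in E *.
set t := om_tau (Some x) in E tx *; set t' := om_tau (Some y) in E ty *.
have two_atE k : two_at w k.+2 <-> two_at w' k.+2.
  have /eqP Ek := E k; rewrite -!Jprod_single_eq0; split => J0; move: Ek;
    rewrite J0 mul0r.
    by rewrite eq_sym mulf_eq0 expf_eq0 (gt_eqF ty) andbF orbF => /eqP.
  by rewrite mulf_eq0 expf_eq0 (gt_eqF tx) andbF orbF => /eqP.
have ww' : w = w'.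
  (* If the digits below [n] agree, the letters at [n] have a common position, and each is a 2
     exactly when its word has a 2 at that position. *)
  apply/funext => n; have [m] := ubnP n; elim: m n => // m IH n nm.
  have pn : letter_pos w n = letter_pos w' n.
    by apply: eq_letter_pos => i i_n; apply: IH; lia.
  case: n => [|n] in nm pn *.
    rewrite -!Jprod_single0_lt0 -(pmulr_llt0 _ (exprn_gt0 2 tx)).
    by rewrite E pmulr_llt0// exprn_gt0.
  have := letter_pos_gt w n.+1.
  case pE : (letter_pos w n.+1) => [|[|k]] // _.
  have [h1 h2] := two_atE k.
  apply/idP/idP => wn.
    have [|l wl lk] := h1; first by exists n.+1.
    by have <- : l = n.+1 by apply: (@letter_pos_inj w'); rewrite -pn pE.
  have [|l wl lk] := h2; first by exists n.+1; rewrite -?pn.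
  by have <- : l = n.+1 by apply: (@letter_pos_inj w); rewrite pE.
congr Some; apply: om_point_eq => //.
(* Once the digits agree, a nonzero [J] isolates [t ^+ k.+2], which determines [t >= 0]. *)
have [k /eqP Jk] := Jprod_single_neq0 w.
have := E k; rewrite -ww' => /(mulfI Jk)/eqP.
by rewrite eqrXn2 ?ltW// => /eqP.
Qed.

End Injectivity.

(** * Compactness *)

Section Boundary.
Variable R : realType.
Implicit Types (w : infword) (u v : fword).

Lemma nbhs_ptws_box (I : choiceType) (h : {ptws I -> R}) (s : seq I) (e : R) :
  0 < e -> nbhs h [set y : {ptws I -> R} | forall i, i \in s -> `|h i - y i| <
    e].
Proof.
move=> e0; elim: s => [|i s IH]; first exact: filterS filterT.
have hi : nbhs h [set y : {ptws I -> R} | `|h i - y i| < e].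
  rewrite (_ : [set _ | _] = @proj I (fun=> R) i @^-1` [set z | `|h i - z| <
    e])//.
  apply: (@proj_continuous I (fun=> R) i h).
  by have := @nbhsx_ballx R R (h i) e e0; rewrite -ball_normE.
apply: filterS (filterI hi IH) => y [yi ys] j.
by rewrite in_cons => /orP[/eqP->|/ys].
Qed.

(** Tychonoff gives a cluster point; [f n] is an index from [n] on at which the first [n]
    coordinates are within [1/(n+1)] of it. The condition [n <= f n] is what [cvg_reindex] uses to
    carry limits over. *)
Lemma bounded_subsequence (y : nat -> nat -> R) : (forall n k, 0 <= y n k <= 1)
  ->
  exists f : nat -> nat, exists l : nat -> R, (forall n, (n <= f n)%N) /\
    forall k, y (f n) k @[n --> \oo] --> l k.
Proof.
move=> y01.
pose K := [set h : {ptws nat -> R} | forall i, `[0, 1]%classic (h i)].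
have cK : compact K.
  have := @tychonoff nat (fun=> R : topologicalType) (fun=> `[0, 1]%classic).
  by apply=> i; exact: segment_compact.
pose F : set_system {ptws nat -> R} := (y : nat -> {ptws nat -> R}) @ \oo.
have FK : F K by exists 0 => // n _ i /=; rewrite in_itv /= y01.
have [l [_ lF]] := cK F (fmap_proper_filter _ eventually_filter) FK.
have step n : exists m, (n <= m)%N /\ forall k, (k < n)%N -> `|l k - y m k| <
  n.+1%:R^-1.
  have e0 : 0 < n.+1%:R^-1 :> R by rewrite invr_gt0.
  have Fn : F [set y m | m in [set m | (n <= m)%N]].
    by exists n => // m /= nm; exists m.
  have [_ [[m nm <-] h]] := lF _ _ Fn (nbhs_ptws_box l (iota 0 n) e0).
  by exists m; split=> // k kn; apply: h; rewrite mem_iota.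
have [f fP] := choice step; exists f, l; split=> [n|k];
  first by have [] := fP n.
apply/cvgrPdist_lt => e e0; near=> n.
have [_ fn] := fP n; apply: lt_trans (fn k _) _.
  by near: n; exact: nbhs_infty_gt.
near: n; have := @cvg_harmonic R; move/cvgrPdist_lt => /(_ e e0).
by apply: filterS => n; rewrite /= sub0r normrN ger0_norm.
Unshelve. all: by end_near. Qed.

Lemma cvg_reindex (T : topologicalType) (z : nat -> T) (l : T) (f : nat -> nat)
  :
  (forall n, (n <= f n)%N) -> z n @[n --> \oo] --> l -> z (f n) @[n --> \oo]
    --> l.
Proof.
move=> nf zl A /zl [N _ NA]; exists N => // n /= Nn; apply: NA => /=.
exact: leq_trans (nf n).
Qed.

(** The bound on [t0] survives because [piw] lies below each partial product, and a partial product
    is eventually constant along the subsequence. *)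
Lemma word_subsequence (x : nat -> infword) (t : nat -> R) :
  (forall n, 0 <= t n <= piw R (x n)) ->
  exists f w (t0 : R), [/\ forall n, (n <= f n)%N,
    forall i, \forall n \near \oo, x (f n) i = w i,
    t (f n) @[n --> \oo] --> t0 & 0 <= t0 <= piw R w].
Proof.
move=> tx.
(* One array carries [t] and all digits; the limit digits are read off with the threshold 1/2. *)
pose y n k : R := if k is i.+1 then (x n i)%:R else t n.
have y01 n k : 0 <= y n k <= 1.
  case: k => [|i] /=; last by case: (x n i); rewrite ?lexx ?ler01.
  have /andP[-> tn] := tx n; apply: le_trans tn _.
  by have /andP[] := piw_itv R (x n).
have [f [l [nf fl]]] := bounded_subsequence y01.
have xw i : \forall n \near \oo, x (f n) i = (2^-1 < l i.+1).
  have /cvgrPdist_lt/(_ 2^-1) := fl i.+1.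
  rewrite invr_gt0 ltr0n => /(_ isT); apply: filterS => n /=.
  rewrite ltr_norml => /andP[h1 h2].
  by case: (x (f n) i) h1 h2 => /= h1 h2; apply/esym; [lra|apply/negbTE;
    rewrite -leNgt; lra].
exists f, (fun i => 2^-1 < l i.+1), (l 0); split=> //; first exact: (fl 0).
have t0 : t (f n) @[n --> \oo] --> l 0 by exact: (fl 0).
apply/andP; split.
  apply: (ler_cvg_to (cvg_cst 0) t0); apply: nearW => n.
  by have /andP[] := tx (f n).
set w := fun i => _; apply: (ler_cvg_to (cvg_cst (l 0)) (@piw_cvg R w)).
apply: nearW => N; apply: (ler_cvg_to t0 (cvg_cst _)).
have : \forall n \near \oo, forall i, (i < N)%N -> x (f n) i = w i.
  elim: N => [|M IH]; first by apply: nearW.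
  near=> n => i; rewrite ltnS leq_eqVlt => /orP[/eqP->|].
    by near: n; exact: xw.
  by move: i; near: n; exact: IH.
apply: filterS => n /(eq_iprod (pifac R)) /= <-.
have /andP[_ tn] := tx (f n); apply: le_trans tn _; exact: piw_le_iprod.
Unshelve. all: by end_near. Qed.

Lemma chi_cvg u (x : nat -> infword) (t : nat -> R) w (t0 : R) :
  (forall i, \forall n \near \oo, x n i = w i) -> t n @[n --> \oo] --> t0 ->
  Jprod R u (x n) * t n ^+ stripped u @[n --> \oo] --> Jprod R u w * t0 ^+
    stripped u.
Proof.
by move=> xw tt; apply: cvgM; [exact: Jprod_continuous|exact: cvgn_exp].
Qed.

(** For [t > 0] the point has [beta = t / piw R w], and [w] is summable because [piw] is positive;
    for [t = 0] it is P, which forgets [w]. *)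
Lemma Omega_of w (t : R) : 0 <= t <= piw R w -> exists o : Omega R,
  [/\ om_tau o = t, 0 < t -> om_digits o = w &
   forall u, Jprod R u (om_digits o) * om_tau o ^+ stripped u =
             Jprod R u w * t ^+ stripped u].
Proof.
move=> /andP[]; rewrite le_eqVlt => /orP[/eqP<- _|t0 tp].
  exists None; split=> //= [|u]; first by rewrite ltxx.
  rewrite expr0n; case: eqP => [u0|_]; last by rewrite !mulr0.
  by rewrite !Jprod_stripped0.
have p0 : 0 < piw R w by apply: lt_le_trans tp.
have b01 : 0 < t / piw R w <= 1 by rewrite divr_gt0//= ler_pdivrMr// mul1r.
exists (Some (OmPoint b01 (piw_gt0_summable p0))) => /=.
by rewrite divfK ?gt_eqF.
Qed.

Lemma martin_kernel_subsequence (v : nat -> fword) :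
  (forall n, (n <= wrank (v n))%N) ->
  exists (f : nat -> nat) (om : Omega R), (forall n, (n <= f n)%N) /\
    forall u, martin_kernel R (v (f n)) u @[n --> \oo] --> phi_Omega om u.
Proof.
move=> nv.
have [|f [w [t0 [nf fw ftt t0w]]]] :=
    @word_subsequence (fun n => pad (v n)) (fun n => piw R (pad (v n))).
  by move=> n; have /andP[-> _] := piw_itv R (pad (v n)); exact: lexx.
have [om [_ _ oE]] := Omega_of t0w; exists f, om; split=> //.
apply: pev_cvg => u; rewrite pev_phi_Omega oE.
apply: cvg_trans (@chi_cvg u _ _ _ _ fw ftt).
apply: near_eq_cvg; exists (wrank u) => // n /= un.
by rewrite pev_martin_kernel_pad// (leq_trans un)// (leq_trans (nf n)).
Qed.

Lemma martin_kernel_limit (v : nat -> fword) (h : fword -> R) :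
  (forall n, (n <= wrank (v n))%N) ->
  (forall u, martin_kernel R (v n) u @[n --> \oo] --> h u) ->
  exists om : Omega R, h = phi_Omega om.
Proof.
move=> nv vh; have [f [om [nf fom]]] := martin_kernel_subsequence nv.
exists om; apply/funext => u.
exact: (cvg_unique _ (cvg_reindex nf (vh u)) (fom u)).
Qed.

(* A sequential form of the continuity of the inverse of [phi_Omega]. *)
Lemma phi_Omega_cvg_open (o : nat -> Omega R) (o0 : Omega R) (U : set (Omega
  R)) :
  (forall u, phi_Omega (o n) u @[n --> \oo] --> phi_Omega o0 u) ->
  Omega_open U -> U o0 -> \forall n \near \oo, U (o n).
Proof.
move=> oo0 oU Uo0; apply: contrapT => nU.
have bad n : exists m, (n <= m)%N /\ ~ U (o m).
  apply: contrapT => /forallNP h; apply: nU; exists n => // m /= nm.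
  by apply: contrapT => Um; apply: (h m).
have [f fP] := choice bad.
have nf n : (n <= f n)%N by have [] := fP n.
have fU n : ~ U (o (f n)) by have [] := fP n.
have [|g [w [t0 [ng gw gtt t0w]]]] :=
    @word_subsequence (fun n => om_digits (o (f n))) (fun n => om_tau (o (f
      n))).
  by move=> n; rewrite om_tau_ge0 om_tau_le.
have nfg n : (n <= f (g n))%N by rewrite (leq_trans (ng n)).
have [om1 [tE wE om1E]] := Omega_of t0w.
have om10 : om1 = o0.
  apply: phi_Omega_inj; apply: pev_inj => u; rewrite pev_phi_Omega om1E.
  have h1 : pev u (phi_Omega (o (f (g n)))) @[n --> \oo] --> pev u (phi_Omega
    o0).
    by apply: pev_continuous => u'; apply: (cvg_reindex nfg (oo0 u')).
  apply: cvg_unique h1 => //; apply: cvg_trans (@chi_cvg u _ _ _ _ gw gtt).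
  by apply: near_eq_cvg; apply: nearW => n; rewrite pev_phi_Omega.
rewrite -{}om10 in Uo0.
(* Openness is tested only on sequences of [om_point]; [d] is a placeholder for terms equal to P,
   shown not to occur eventually. *)
suff [d dU] : exists d : om_point R, \forall n \near \oo,
    U (Some (if o (f (g n)) is Some z then z else d)) /\ (o (f (g n)) = None ->
      False).
  have [N _ /(_ N (leqnn N)) /= [UN oN]] := dU.
  by apply: (fU (g N)); move: UN oN; case: (o _) => [z|] // _ /(_ erefl).
case: om1 Uo0 tE wE om1E => [y|] Uo1 /= tE wE _; last first.
  (* Here P lies in [U], while all terms lie outside [U]. *)
  have someP n : exists z, o (f (g n)) = Some z.
    by move: (fU (g n)); case: (o _) => [z|//]; exists z.
  have [z zE] := choice someP; exists (z 0).
  have zP : \forall n \near \oo, U (Some (z n)).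
    have [_ hz] := @Omega_cvgP R z None; apply: (hz _ U).
      rewrite tE; apply: cvg_trans gtt; apply: near_eq_cvg.
      by apply: nearW => n; rewrite zE.
    by exists U; split=> //; exact: subset_refl.
  by apply: filterS zP => n; rewrite zE.
exists y.
have t0p : 0 < t0 by rewrite -tE; exact: om_tau_gt0.
have some : \forall n \near \oo, o (f (g n)) <> None.
  have /cvgrPdist_lt/(_ t0 t0p) := gtt; apply: filterS => n tn on.
  by move: tn; rewrite on /= subr0 gtr0_norm// ltxx.
have wy := wE t0p.
near=> n; split; last by near: n.
near: n; apply: (oU _ (Some y) Uo1); split=> [i|].
  near=> n.
  have gwn : om_digits (o (f (g n))) i = w i by near: n; exact: gw.
  have : o (f (g n)) <> None by near: n; exact: some.
  by move: gwn; rewrite -wy /=; case: (o _).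
rewrite tE; apply: cvg_trans gtt; apply: near_eq_cvg.
by apply: filterS some => n /=; case: (o _).
Unshelve. all: by end_near. Qed.

End Boundary.

(** * The Martin boundary *)

Section Homeomorphism.
Variable R : realType.
Implicit Types (u v w : fword).

Lemma subsequence_cvg (z : nat -> R) (l : R) :
  (forall f : nat -> nat, (forall n, (n <= f n)%N) ->
    exists2 g : nat -> nat, (forall n, (n <= g n)%N) & z (f (g n)) @[n --> \oo]
      --> l) ->
  z n @[n --> \oo] --> l.
Proof.
move=> zP; apply/cvgrPdist_lt => e e0; apply: contrapT => nz.
have bad n : exists m, (n <= m)%N /\ ~ `|l - z m| < e.
  apply: contrapT => /forallNP h; apply: nz; exists n => // m /= nm.
  by apply: contrapT => zm; apply: (h m).
have [f fP] := choice bad.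
have [|g ng /cvgrPdist_lt/(_ e e0)[N _ /(_ N (leqnn N))]] := zP f.
  by move=> n; have [] := fP n.
by have [] := fP (g N).
Qed.

(** The digits need not converge when the limit is P. Convergence is tested along subsequences where
    they do, and [0 ^+ stripped u] then removes the dependence on their limit. *)
Lemma phi_Omega_pointwise (x : nat -> om_point R) (om : Omega R) : conv_Omega x
  om ->
  forall v, phi_Omega (Some (x n)) v @[n --> \oo] --> phi_Omega om v.
Proof.
move=> xo; apply: pev_cvg => u; apply: subsequence_cvg => f nf.
have [|g [w [t0 [ng gw gtt t0w]]]] :=
  @word_subsequence R (fun n => om_word (x (f n))) (fun n => om_tau (Some (x (f
    n)))).
  by move=> n; rewrite om_tau_ge0 (om_tau_le (Some _)).
exists g => //.
have nfg n : (n <= f (g n))%N by rewrite (leq_trans (ng n)).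
have tau : om_tau (Some (x n)) @[n --> \oo] --> om_tau om.
  have /Omega_cvgP : Some (x n) @[n --> \oo] --> om.
    by move=> A [B [oB Bp BA]]; apply: filterS (oB x om Bp xo) => n /BA.
  by case: om xo => [y|] // _ [].
have t0E : t0 = om_tau om.
  exact: (cvg_unique _ gtt (cvg_reindex nfg tau)).
rewrite pev_phi_Omega.
have -> : Jprod R u (om_digits om) * om_tau om ^+ stripped u =
    Jprod R u w * t0 ^+ stripped u.
  rewrite t0E; case: om xo tau t0E => [y [wy _]|_] _ _ /=.
    congr (_ * _); congr (Jprod _ _ _); apply/funext => i.
    have [N _ wyN] := wy i; have [M _ gwM] := gw i.
    have <- := gwM (maxn M N) (leq_maxl _ _).
    by rewrite (wyN (f (g (maxn M N))))//= (leq_trans _ (nfg _))// leq_maxr.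
  rewrite expr0n; case: eqP => [u0|_]; last by rewrite !mulr0.
  by rewrite !Jprod_stripped0.
apply: cvg_trans (@chi_cvg R u _ _ _ _ gw gtt).
apply: near_eq_cvg; apply: nearW => n.
exact/esym/(pev_phi_Omega u (Some _)).
Qed.

Lemma harmonic_phi_Omega (om : Omega R) : harmonic (phi_Omega om).
Proof.
by apply: pev_harmonic => u; rewrite !pev_phi_Omega Jprod_one stripped_one.
Qed.

Lemma phi_Omega_nil (om : Omega R) : phi_Omega om [::] = 1.
Proof.
have := pev_phi_Omega [::] om; rewrite /= => ->.
by rewrite Jprod_nil /stripped wrank_nil mulr1.
Qed.

Lemma prodf_pifac_itv v : 0 < prodf (pifac R) v <= 1.
Proof.
elim: v => [|[] v /andP[IH0 IH1]] /=; rewrite ?ltr01 ?lexx ?IH0//.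
rewrite mulr_gt0 ?pifac_gt0//= mulr_ile1//; [exact: pifac_ge0|exact: ltW|].
exact: pifac_le1.
Qed.

Lemma wrank_nseq2 k v : wrank (nseq k true ++ v) = (k.*2 + wrank v)%N.
Proof. by elim: k => [|k IH] //=; rewrite wrank_two IH. Qed.

(* Squaring the product over the positions [b] of the added 2's and bounding
   [(1 - 1/b)^2] by [(1 - 1/b) * (1 - 1/(b+1))] makes it telescope. *)
Lemma prodf_twos_bound v k : (0 < wrank v)%N ->
  prodf (pifac R) (nseq k true ++ v) ^+ 2 * (k.*2 + wrank v)%:R <= (wrank v)%:R.
Proof.
move=> v0; elim: k => [|k IH].
  have /andP[p0 p1] := prodf_pifac_itv v.
  by rewrite add0n ler_piMl// exprn_ile1// ltW.
apply: le_trans IH; rewrite /= wrank_nseq2.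
set n := (k.*2 + wrank v)%N; set p := prodf _ _.
have n0 : (0 < n)%N by rewrite /n; lia.
rewrite exprMn mulrC mulrA [X in _ <= X]mulrC ler_wpM2r ?sqr_ge0//.
rewrite doubleS !addSn -/n /pifac ifT; last by lia.
have nn : 0 < n%:R :> R by rewrite ltr0n.
rewrite -!natr1; set m := n%:R in nn *.
have m1 : m + 1 != 0 by rewrite gt_eqF// ltr_wpDl// ltW.
have -> : (m + 1 + 1) * (1 - (m + 1)^-1) ^+ 2 = m - m / (m + 1) ^+ 2.
  by field.
by rewrite gerBl divr_ge0 ?sqr_ge0// ltW.
Qed.

Lemma prodf_twos_small v (e : R) : (0 < wrank v)%N -> 0 < e ->
  exists k, prodf (pifac R) (nseq k true ++ v) <= e.
Proof.
move=> v0 e0; pose k := (Num.truncn ((wrank v)%:R / e ^+ 2)).+1.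
exists k; have /andP[p0 _] := prodf_pifac_itv (nseq k true ++ v).
rewrite -(ler_pXn2r (n := 2)) ?nnegrE ?ltW//.
have kb : (wrank v)%:R < e ^+ 2 * (k.*2 + wrank v)%:R.
  rewrite mulrC -ltr_pdivrMr ?exprn_gt0//; apply: lt_le_trans (truncnS_gt _) _.
  by rewrite ler_nat -/k; lia.
have := le_lt_trans (prodf_twos_bound k v0) kb.
rewrite ltr_pM2r => [//|].
by rewrite ltr0n; lia.
Qed.

(** The truncation of [w] has a product of at least [piw R w >= t]; 2's are added on the left until
    the product first drops to [t + 1/N]. The last 2 stands beyond position [N] and lowers the
    product by at most [1/N], so it does not fall below [t]. *)
Lemma word_approx (w : infword) (t : R) : 0 <= t <= piw R w -> forall N, (0 <
  N)%N ->
  exists v, [/\ (N <= size v)%N, forall i, (i < N)%N -> pad v i = w i &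
    `|prodf (pifac R) v - t| <= 2 / N%:R].
Proof.
move=> /andP[t0 tw] N N0; set e := N%:R^-1 : R.
have e0 : 0 < e by rewrite invr_gt0 ltr0n.
have e1 : e <= 1 by rewrite invf_le1 ?ler1n// ltr0n.
set v0 := trunc w N; have sv0 : size v0 = N by rewrite size_trunc.
have rv0 : (N <= wrank v0)%N by rewrite -[X in (X <= _)%N]sv0 size_wrank.
have te : 0 < t + e by rewrite ltr_wpDl.
have [|k0 k0P] := @prodf_twos_small v0 (t + e) _ te; first by lia.
have ex : exists k, prodf (pifac R) (nseq k true ++ v0) <= t + e by exists k0.
have t1 : t <= 1 by apply: le_trans tw _; have /andP[] := piw_itv R w.
have [k kP kmin] := ex_minnP ex.
exists (nseq k true ++ v0); split.
- by rewrite size_cat sv0 leq_addl.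
- move=> i iN; rewrite /pad rev_cat nth_cat size_rev sv0 iN.
  exact: pad_trunc.
have kmin' j : (j < k)%N -> t + e < prodf (pifac R) (nseq j true ++ v0).
  by move=> jk; rewrite ltNge; apply/negP => /kmin; lia.
rewrite ler_norml; apply/andP; split; last first.
  rewrite lerBlDr; apply: le_trans kP _; rewrite addrC lerD2r -/e.
  by move: (e) e0 => e' e0'; lra.
rewrite lerBrDr.
have e2 : - (2 / N%:R) + t <= t by rewrite gerDr oppr_le0 divr_ge0.
case: k kP kmin kmin' => [|k] kP kmin kmin'.
  apply: (le_trans e2); apply: (le_trans tw);
    apply: (le_trans (@piw_le_iprod R w N)).
  rewrite /= -iprod_pad_size sv0 (@eq_iprod _ _ w (pad v0))// => i iN.
  by rewrite pad_trunc.
have := kmin' k (ltnSn k); set p := prodf _ _ => tp.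
rewrite /= -/p wrank_nseq2; set b := (k.*2 + _)%N.
have Nb : (N <= b)%N by rewrite /b; lia.
have b1 : b.+1%:R^-1 <= e by rewrite lef_pV2 ?posrE ?ltr0n ?ler_nat// ltnW.
rewrite /pifac ifT; last by lia.
have p1 : p <= 1 by have /andP[] := prodf_pifac_itv (nseq k true ++ v0).
have p0 : 0 <= p by have /andP[/ltW] := prodf_pifac_itv (nseq k true ++ v0).
have y0 : 0 <= b.+1%:R^-1 :> R by rewrite invr_ge0.
rewrite -/e; move: (b.+1%:R^-1) y0 b1 => y y0 b1.
have : p * y <= y by rewrite ler_piMl.
by nra.
Qed.

Lemma martin_kernel_approx (om : Omega R) : exists v : nat -> fword,
  (forall n, (n <= wrank (v n))%N) /\
  forall u, martin_kernel R (v n) u @[n --> \oo] --> phi_Omega om u.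
Proof.
have tw : 0 <= om_tau om <= piw R (om_digits om) by rewrite om_tau_ge0
  om_tau_le.
have /choice[v vP] N : exists v, [/\ (N.+1 <= size v)%N,
    forall i, (i < N.+1)%N -> pad v i = om_digits om i &
    `|prodf (pifac R) v - om_tau om| <= 2 / N.+1%:R].
  exact: (word_approx tw).
have nv n : (n <= wrank (v n))%N.
  by have [/ltnW sv _ _] := vP n; exact: leq_trans sv (size_wrank _).
exists v; split=> //; apply: pev_cvg => u; rewrite pev_phi_Omega.
have dig i : \forall n \near \oo, pad (v n) i = om_digits om i.
  by exists i => // n /= ni; have [_ + _] := vP n; apply.
have tauc : piw R (pad (v n)) @[n --> \oo] --> om_tau om.
  have vE n : piw R (pad (v n)) = prodf (pifac R) (v n).
    exact: (cvg_unique _ (@piw_cvg R (pad (v n))) (@limn_iprod_pad R (pifac R)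
      (v n))).
  apply/cvgrPdist_le => e e0.
  have : \forall n \near \oo, n.+1%:R^-1 < e / 2.
    have := @cvg_harmonic R; move/cvgrPdist_lt => /(_ (e / 2)).
    rewrite divr_gt0// => /(_ isT); apply: filterS => n.
    by rewrite /= sub0r normrN ger0_norm.
  apply: filterS => n ne; have [_ _] := vP n; rewrite vE distrC => h.
  by apply: le_trans h _; rewrite mulrC -ler_pdivlMr// ltW.
apply: cvg_trans (@chi_cvg R u _ _ _ _ dig tauc).
apply: near_eq_cvg; exists (wrank u) => // n /= un.
by rewrite pev_martin_kernel_pad// (leq_trans un).
Qed.

Lemma martin_kernel_ge0 w u : 0 <= martin_kernel R w u.
Proof. by rewrite divr_ge0. Qed.

Lemma phi_Omega_ge0 (om : Omega R) u : 0 <= phi_Omega om u.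
Proof.
have [v [_ /(_ u) vu]] := martin_kernel_approx om.
by apply: (ler_cvg_to (cvg_cst 0) vu); apply: nearW => n;
  exact: martin_kernel_ge0.
Qed.

(** The kernel is positive at [w] and zero on the upper covers of [w]. This keeps the functions
    [phi_Omega om] out of [martin_image]. *)
Lemma harmonic_martin_kernel w : ~ harmonic (martin_kernel R w).
Proof.
move=> /harmonicE /(congr1 (@^~ w));
  rewrite /Ut big_seq big1 => [|x /wrank_ups wx].
  move/esym/eqP; rewrite /martin_kernel nchains_eq_rank// eqxx div1r invr_eq0.
  by rewrite pnatr_eq0 eqn0Ngt (dim_gt0 R).
by rewrite /martin_kernel nchains_gt ?wx// mul0r.
Qed.

Lemma cvg_ptws (h : nat -> {ptws fword -> R}) (h0 : {ptws fword -> R}) :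
  (forall u, h n u @[n --> \oo] --> h0 u) -> h n @[n --> \oo] --> h0.
Proof.
move=> hh; have [_] := @pointwise_cvgP (discrete_topology fword) R (h @ \oo) h0
  _.
exact.
Qed.

Lemma phi_Omega_boundary (om : Omega R) : martin_boundary R (phi_Omega om).
Proof.
split.
  have [v [_ vP]] := martin_kernel_approx om => B Bo.
  have [N _ /(_ N (leqnn N)) BN] := cvg_ptws vP Bo.
  by exists (martin_kernel R (v N)); split=> //; exists (v N).
by move=> [w _ wo]; apply: (@harmonic_martin_kernel w); rewrite wo;
  exact: harmonic_phi_Omega.
Qed.

(** Since [h] is a limit of kernels but not a kernel, each word is eventually avoided by the
    approximating sequence. Only finitely many words have bounded rank, so the ranks tend to
    infinity. *)
Lemma boundary_phi_Omega (h : {ptws fword -> R}) : martin_boundary R h ->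
  exists om : Omega R, h = phi_Omega om.
Proof.
move=> [ch nh].
pose ws n := flatten [seq words k | k <- iota 0 n].
have wsP n v : (v \in ws n) = (wrank v < n)%N.
  apply/flatten_mapP/idP => [[k]|vn];
    first by rewrite mem_iota mem_words => kn /eqP->.
  by exists (wrank v); rewrite ?mem_iota ?mem_words.
have /choice[v vP] n : exists v, forall u, (wrank u < n)%N ->
    `|h u - martin_kernel R v u| < n.+1%:R^-1.
  have [|_ [[v _ <-] vP]] := ch _ (nbhs_ptws_box h (ws n) (_ : 0 < n.+1%:R^-1)).
    by rewrite invr_gt0.
  by exists v => u un; apply: vP; rewrite wsP.
have vh u : martin_kernel R (v n) u @[n --> \oo] --> h u.
  apply/cvgrPdist_lt => e e0; near=> n.
  apply: lt_trans (vP n _ _) _; first by near: n; exact: nbhs_infty_gt.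
  near: n; have := @cvg_harmonic R; move/cvgrPdist_lt => /(_ e e0).
  by apply: filterS => n; rewrite /= sub0r normrN ger0_norm.
have vw w : \forall n \near \oo, v n <> w.
  have [u uP] : exists u, martin_kernel R w u <> h u.
    apply: contrapT => /forallNP hw; apply: nh; exists w => //.
    by apply/funext => u; apply: contrapT; exact: hw.
  have e0 : 0 < `|h u - martin_kernel R w u|.
    by rewrite normr_gt0 subr_eq0; apply/eqP => /esym.
  move/cvgrPdist_lt: (vh u) => /(_ _ e0); apply: filterS => n + vn.
  by rewrite vn ltxx.
have vr M : \forall n \near \oo, (M <= wrank (v n))%N.
  have : \forall n \near \oo, forall w, w \in ws M -> v n <> w.
    elim: (ws M) => [|w s IH]; first by apply: nearW.
    apply: filterS2 (vw w) IH => n nw ns w'.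
    by rewrite in_cons => /orP[/eqP->|/ns].
  by apply: filterS => n nM; rewrite leqNgt -wsP; apply/negP => /nM.
have /choice[f fP] n : exists m, (n <= m)%N /\ (n <= wrank (v m))%N.
  have [N _ NP] := vr n; exists (maxn n N); split; first exact: leq_maxl.
  by apply: NP; rewrite /= leq_maxr.
apply: (@martin_kernel_limit R (v \o f)) => [n|u].
  by have [] := fP n.
by apply: (cvg_reindex _ (vh u)) => n; have [] := fP n.
Unshelve. all: by end_near. Qed.

Lemma homeomorphism_phi_Omega : homeomorphism_onto (@phi_Omega R)
  (martin_boundary R).
Proof.
pose g (h : {ptws fword -> R}) : Omega R := xget (None : Omega R) [set om |
  phi_Omega om = h].
have gK : cancel (@phi_Omega R) g.
  move=> om; apply: phi_Omega_inj.
  by apply: (@xgetPex (Omega R) (None : Omega R) [set om' | phi_Omega om' =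
    phi_Omega om]); exists om.
split.
- split=> [om _|om om' _ _|h /boundary_phi_Omega[om ->]].
  + exact: phi_Omega_boundary.
  + exact: phi_Omega_inj.
  + by exists om.
(* Openness of the preimage unfolds to [Omega_open], so sequential continuity is enough. *)
- apply/continuousP => B oB; move=> x om Bom xo.
  have := cvg_ptws (phi_Omega_pointwise xo); apply.
  exact: open_nbhs_nbhs.
exists g => //; apply/subspace_continuousP => h /boundary_phi_Omega[om ->].
rewrite /from_subspace gK => U [V [openV Vom VU]].
apply: contrapT => nU.
pose ws n := flatten [seq words k | k <- iota 0 n].
have wsP n v : (wrank v < n)%N -> v \in ws n.
  by move=> vn; apply/flatten_mapP; exists (wrank v);
    rewrite ?mem_iota ?mem_words.
(* If continuity fails, every box on the words of rank below [n] contains an image of a point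
   outside [V]; these points contradict [phi_Omega_cvg_open]. *)
have /choice[z zP] n : exists om' : Omega R, (forall u, (wrank u < n)%N ->
    `|phi_Omega om u - phi_Omega om' u| < n.+1%:R^-1) /\ ~ V om'.
  apply: contrapT => /forallNP hz; apply: nU.
  have e0 : 0 < n.+1%:R^-1 :> R by rewrite invr_gt0.
  apply: filterS (nbhs_ptws_box (phi_Omega om) (ws n) e0) => y yP.
  move=> /boundary_phi_Omega[om' yE]; rewrite yE /= gK; apply: VU.
  apply: contrapT => nO; apply: (hz om'); split=> // u un.
  by rewrite -yE; apply: yP; exact: wsP.
have zc u : phi_Omega (z n) u @[n --> \oo] --> phi_Omega om u.
  apply/cvgrPdist_lt => e e0; near=> n.
  have [zn _] := zP n.
  apply: lt_trans (zn _ _) _; first by near: n; exact: nbhs_infty_gt.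
  near: n; have := @cvg_harmonic R; move/cvgrPdist_lt => /(_ e e0).
  by apply: filterS => n; rewrite /= sub0r normrN ger0_norm.
have [N _ /(_ N (leqnn N))] := phi_Omega_cvg_open zc openV Vom.
by have [] := zP N.
Unshelve. all: by end_near. Qed.

End Homeomorphism.

(** * Integral representations *)

Section Mixtures.
Variable R : realType.
Implicit Types (u v w : fword).

Lemma integrable_itv01 d (T : measurableType d) (P : probability T R) (f : T ->
  R) :
  measurable_fun setT f -> (forall x, 0 <= f x <= 1) ->
  P.-integrable setT (EFin \o f).
Proof.
move=> mf f01; apply: measurable_bounded_integrable => //.
  by apply: (le_lt_trans (probability_le1 P measurableT)); exact: ltry.
exists 1; split; first exact: num_real.
move=> M M1 x _ /=; have /andP[f0 f1] := f01 x.
by rewrite ger0_norm// (le_trans f1)// ltW.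
Qed.

Lemma measurable_phi_Omega v :
  measurable_fun setT (fun om : borel_Omega R => phi_Omega om v).
Proof.
apply: (measurability _ (RGenOInfty.measurableE R)) => _ [_ [a ->] <-].
rewrite setTI; apply: sub_sigma_algebra.
move=> x om omab xo; apply: (@phi_Omega_pointwise R x om xo v).
apply: open_nbhs_nbhs; split=> //; exact: interval_open.
Qed.

(** For a lower cover [u] of [v], the value [h v] is one of the nonnegative terms summing to [h u];
    descend to the empty word. *)
Lemma nonneg_harmonic_le (h : fword -> R) v : (forall u, 0 <= h u) -> harmonic
  h ->
  h v <= h [::].
Proof.
move=> h0 /harmonicE hh; have [n] := ubnP (wrank v);
  elim: n v => // n IH v lt_v.
case vE : (downs v) => [|u s]; first by case: v vE {lt_v} => [|[] v].
have uv : u \in downs v by rewrite vE mem_head.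
apply: le_trans (IH u _); last by have := wrank_downs uv; lia.
rewrite -[in leRHS]hh /Ut (bigD1_seq v) ?ups_uniq//=;
  last by rewrite -mem_downs.
by rewrite lerDl sumr_ge0.
Qed.

Lemma phi_Omega_itv (om : Omega R) v : 0 <= phi_Omega om v <= 1.
Proof.
rewrite phi_Omega_ge0/= -(phi_Omega_nil om) nonneg_harmonic_le//.
  by move=> u; exact: phi_Omega_ge0.
exact: harmonic_phi_Omega.
Qed.

Lemma integrable_phi_Omega (M : probability (borel_Omega R) R) v :
  M.-integrable [set: borel_Omega R] (fun om => (phi_Omega om v)%:E).
Proof.
apply: (@integrable_itv01 _ _ M (fun om => phi_Omega om v)).
  exact: measurable_phi_Omega.
by move=> om; exact: phi_Omega_itv.
Qed.

Lemma Rintegral_sum d (T : measurableType d) (P : probability T R) (I : Type)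
    (s : seq I) (f : I -> T -> R) :
  (forall i, P.-integrable setT (EFin \o f i)) ->
  P.-integrable setT (EFin \o (fun x => \sum_(i <- s) f i x)) /\
  \int[P]_x (\sum_(i <- s) f i x) = \sum_(i <- s) \int[P]_x f i x.
Proof.
move=> fi; elim: s => [|i s [IH1 IH2]].
  rewrite big_nil (_ : (fun x => _) = fun=> 0); last by apply/funext => x;
    rewrite big_nil.
  split; last by rewrite Rintegral_cst// mul0r.
  by apply: integrable_itv01 => // x; rewrite lexx ler01.
rewrite big_cons -IH2.
rewrite (_ : (fun x => _) = fun x => f i x + \sum_(j <- s) f j x); last first.
  by apply/funext => x; rewrite big_cons.
split; last exact: RintegralD.
exact: (integrableD measurableT (fi i) IH1).
Qed.

Lemma mixture_harmonic (M : probability (borel_Omega R) R) :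
  nonneg_normalized_harmonic (fun v => \int[M]_om phi_Omega om v).
Proof.
split.
- by move=> v; apply: Rintegral_ge0 => om _; exact: phi_Omega_ge0.
- move=> u; rewrite sum_words_up.
  have [_ <-] := @Rintegral_sum _ _ M _ (ups u) (fun v om => phi_Omega om v)
    (integrable_phi_Omega M).
  apply: eq_Rintegral => om _; have /harmonicE hh := harmonic_phi_Omega om.
  by rewrite -[in LHS]hh.
- rewrite (@eq_Rintegral _ _ _ _ _ (fun=> 1)); last by move=> om _;
    rewrite phi_Omega_nil.
  rewrite Rintegral_cst// mul1r; exact: (congr1 fine (probability_setT M)).
Qed.

End Mixtures.

(** * Bit sequences and nested intervals *)

(* Bit sequences are stored with the most recent bit first. *)
Definition bit (s : seq bool) i := nth false (rev s) i.

Lemma bit_cons (b : bool) s i : (i < size s)%N -> bit (b :: s) i = bit s i.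
Proof. by move=> si; rewrite /bit rev_cons nth_rcons size_rev si. Qed.

Definition prefix_of (c : nat -> bool) j : seq bool := rev (mkseq c j).

Lemma prefix_ofS c j : prefix_of c j.+1 = c j :: prefix_of c j.
Proof. by rewrite /prefix_of mkseqS rev_rcons. Qed.

Lemma size_prefix_of c j : size (prefix_of c j) = j.
Proof. by rewrite size_rev size_mkseq. Qed.

Lemma bit_prefix_of c j i : (i < j)%N -> bit (prefix_of c j) i = c i.
Proof. by move=> ij; rewrite /bit revK nth_mkseq. Qed.

Fixpoint bitseqs j : seq (seq bool) :=
  if j is j'.+1 then map (cons false) (bitseqs j') ++ map (cons true) (bitseqs
    j')
  else [:: [::]].

Lemma mem_bitseqs j s : (s \in bitseqs j) = (size s == j).
Proof.
elim: j s => [|j IH] [|b s] //=; first by rewrite mem_cat !nil_map_cons.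
by rewrite mem_cat !mem_map_cons !IH eqSS; case: b; rewrite /= ?orbF.
Qed.

Lemma bitseqs_uniq j : uniq (bitseqs j).
Proof.
elim: j => [|j IH] //=; rewrite cat_uniq !map_inj_uniq ?IH ?andbT//=;
  try exact: cons_inj.
by apply/hasPn => _ /mapP[s _ ->]; rewrite mem_map_cons.
Qed.

Section Intervals.
Variables (R : realType) (m : seq bool -> R).
Hypothesis m_nil : m [::] = 1.
Hypothesis mD : forall s, m s = m (false :: s) + m (true :: s).
Hypothesis m_ge0 : forall s, 0 <= m s.

(* The interval of [s] starts at [left_end s] and has length [m s]; those of
   [0 :: s] and [1 :: s] are its left and right parts. *)
Fixpoint left_end (s : seq bool) : R :=
  match s with
  | [::] => 0
  | false :: s' => left_end s'
  | true :: s' => left_end s' + m (false :: s')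
  end.

Fixpoint locate (t : R) j : seq bool :=
  if j is j'.+1 then
    let s := locate t j' in (left_end s + m (false :: s) <= t) :: s
  else [::].

Lemma size_locate t j : size (locate t j) = j.
Proof. by elim: j => //= j ->. Qed.

Lemma locate_itv t j : 0 <= t < 1 ->
  left_end (locate t j) <= t < left_end (locate t j) + m (locate t j).
Proof.
move=> t01; elim: j => [|j /andP[IH1 IH2]] /=; first by rewrite m_nil add0r.
set s := locate t j in IH1 IH2 *;
  case: (leP (left_end s + m (false :: s)) t) => st /=.
  by rewrite st/= -addrA -mD.
by rewrite IH1.
Qed.

Lemma itv_locate t s : left_end s <= t < left_end s + m s ->
  0 <= t < 1 /\ locate t (size s) = s.
Proof.
elim: s => [|b s IH] /=; first by rewrite m_nil add0r.
case: b => /andP[h1 h2].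
  have [|-> ->] := IH; last by rewrite h1.
  rewrite mD addrA h2 andbT; apply: le_trans h1.
  by rewrite lerDl.
have [|-> ->] := IH; last by rewrite leNgt h2.
by rewrite h1/= (lt_le_trans h2)// lerD2l [m s]mD lerDl.
Qed.

(** The half-open interval contains [t], so its length is not zero. *)
Lemma m_locate_gt0 t j : 0 <= t < 1 -> 0 < m (locate t j).
Proof.
by move=> /(locate_itv j)/andP[h1 h2]; have := le_lt_trans h1 h2; rewrite ltrDl.
Qed.

Lemma left_end_itv s : 0 <= left_end s /\ left_end s + m s <= 1.
Proof.
elim: s => [|b s [IH1 IH2]] /=; first by rewrite m_nil add0r.
case: b.
  by split; [rewrite addr_ge0|rewrite -addrA -mD].
by split=> //; apply: le_trans IH2; rewrite lerD2l [m s]mD lerDl.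
Qed.

End Intervals.

(** * Coding kernels by bits and the masses of cylinders *)

Section Representation.
Variable R : realType.
Implicit Types (u v w : fword).

Lemma harmonic_sum_words (h : fword -> R) v n : harmonic h -> (wrank v <= n)%N
  ->
  h v = \sum_(w <- words n) h w * (nchains v w)%:R.
Proof.
move=> hh; have [k] := ubnP (n - wrank v); elim: k v => // k IH v lt_k.
rewrite leq_eqVlt => /orP[/eqP vn|vn].
  rewrite (bigD1_seq v) ?words_uniq ?mem_words ?vn//= nchains_eq_rank// eqxx
    mulr1.
  rewrite big_seq_cond big1 ?addr0// => w /andP[]; rewrite mem_words => /eqP wn.
  by rewrite eq_sym => /negbTE wv; rewrite nchains_eq_rank ?wn// wv mulr0.
have /harmonicE hhE := hh; rewrite -[in LHS]hhE /Ut.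
transitivity (\sum_(x <- ups v) \sum_(w <- words n) h w * (nchains x w)%:R).
  rewrite big_seq [RHS]big_seq; apply: eq_bigr => x /wrank_ups xv.
  by apply: IH; lia.
rewrite exchange_big /= big_seq [RHS]big_seq; apply: eq_bigr => w.
rewrite mem_words => /eqP wn; rewrite nchains_ups.
have [vw|_] := eqVneq v w; first by rewrite vw wn ltnn in vn.
by rewrite add0n natr_sum big_distrr.
Qed.

Lemma nchains_le_dim v w : (nchains v w <= dim w)%N.
Proof.
have [n] := ubnP (wrank v); elim: n v => // n IH v lt_v.
case vE : (downs v) => [|u s]; first by case: v vE {lt_v} => [|[] v].
have uv : u \in downs v by rewrite vE mem_head.
apply: leq_trans (IH u _); last by have := wrank_downs uv; lia.
rewrite (nchains_ups u) (bigD1_seq v) ?ups_uniq//=; last by rewrite -mem_downs.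
by rewrite addnCA leq_addr.
Qed.

Lemma martin_kernel_itv w v : 0 <= martin_kernel R w v <= 1.
Proof.
rewrite martin_kernel_ge0/= /martin_kernel ler_pdivrMr ?ltr0n ?(dim_gt0 R)//.
by rewrite mul1r ler_nat nchains_le_dim.
Qed.

(** The sum is the ceiling of [y]. Thus [L] threshold bits fix a number in [0, 1] up to [1/L]. *)
Lemma threshold_sum (y : R) L : 0 <= y <= L%:R ->
  `|y - \sum_(i < L) (i%:R < y)%R%:R| <= 1.
Proof.
pose S L : R := \sum_(i < L) (i%:R < y)%R%:R.
move=> /andP[y0 yL].
suff [A _ C] : [/\ S L <= y + 1, L%:R <= y -> S L = L%:R & y <= L%:R -> y <= S
  L].
  by rewrite -/(S L) ler_norml; have := C yL; lra.
elim: {yL} L => [|L [A B C]].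
  by rewrite /S big_ord0; split=> //; lra.
have -> : S L.+1 = S L + (L%:R < y)%R%:R by rewrite /S big_ord_recr.
rewrite -natr1; case: ltP => yL /=; rewrite ?addr0.
  by have SL := B (ltW yL); split; lra.
by split=> [|h|h]; [|lra|exact: C].
Qed.

(* The bit with index [(v, L, i)] tells whether [i / L < K(v, w)]. *)
Definition kernel_bit w j : bool :=
  if (choice.unpickle j : option (seq bool * nat * nat)) is Some (v, L, i)
  then i%:R < L%:R * martin_kernel R w v else false.

Definition bit_average v L (s : seq bool) : R :=
  L%:R^-1 * \sum_(i < L) (bit s (choice.pickle (v : seq bool, L, val i)))%:R.

Definition depth v L : nat := \max_(i < L) (choice.pickle (v : seq bool, L, val
  i)).+1.

Lemma depthP v L (i : 'I_L) : (choice.pickle (v : seq bool, L, val i) < depth v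
  L)%N.
Proof. exact: (leq_bigmax i). Qed.

Lemma bit_average_cons v L (b : bool) s : (depth v L <= size s)%N ->
  bit_average v L (b :: s) = bit_average v L s.
Proof.
move=> ds; rewrite /bit_average; congr (_ * _); apply: eq_bigr => i _.
by rewrite bit_cons// (leq_trans (depthP v i)).
Qed.

Lemma kernel_approx v w L j : (0 < L)%N -> (depth v L <= j)%N ->
  `|martin_kernel R w v - bit_average v L (prefix_of (kernel_bit w) j)| <=
    L%:R^-1.
Proof.
move=> L0 dj; have L0' : 0 < L%:R :> R by rewrite ltr0n.
have /andP[k0 k1] := martin_kernel_itv w v.
have yb : 0 <= L%:R * martin_kernel R w v <= L%:R.
  by rewrite mulr_ge0//= -[leRHS]mulr1 ler_pM2l.
have := threshold_sum yb.
have -> : \sum_(i < L) (i%:R < L%:R * martin_kernel R w v)%R%:R =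
    L%:R * bit_average v L (prefix_of (kernel_bit w) j).
  rewrite /bit_average mulVKf ?gt_eqF//; apply: eq_bigr => i _.
  by rewrite bit_prefix_of ?(leq_trans (depthP v i))// /kernel_bit
    choice.pickleK.
rewrite -mulrBr normrM gtr0_norm// => h.
by rewrite -[leRHS]mulr1 ler_pdivlMl.
Qed.

Variable f : fword -> R.
Hypothesis f_nnh : nonneg_normalized_harmonic f.

Let f_ge0 v : 0 <= f v. Proof. by have [+ _ _] := f_nnh; apply. Qed.
Let f_harm : harmonic f. Proof. by have [_ + _] := f_nnh. Qed.
Let f_nil : f [::] = 1. Proof. by have [_ _ +] := f_nnh. Qed.

Definition dim_weight w := f w * (dim w)%:R.

Lemma dim_weight_ge0 w : 0 <= dim_weight w. Proof. by rewrite mulr_ge0. Qed.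

Lemma sum_dim_weight n : \sum_(w <- words n) dim_weight w = 1.
Proof. by rewrite -f_nil (@harmonic_sum_words _ [::] n)// wrank_nil. Qed.

Lemma sum_dim_weight_kernel v n : (wrank v <= n)%N ->
  f v = \sum_(w <- words n) dim_weight w * martin_kernel R w v.
Proof.
move=> vn; rewrite (harmonic_sum_words f_harm vn); apply: eq_bigr => w _.
rewrite /dim_weight /martin_kernel mulrAC -mulrA -[X in _ = _ * X]mulrA mulVf
  ?mulr1//.
by rewrite pnatr_eq0 -lt0n (dim_gt0 R).
Qed.

Definition mass n (s : seq bool) : R :=
  \sum_(w <- words n | prefix_of (kernel_bit w) (size s) == s) dim_weight w.

Lemma mass_ge0 n s : 0 <= mass n s.
Proof. by apply: sumr_ge0 => w _; exact: dim_weight_ge0. Qed.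

Lemma mass_nil n : mass n [::] = 1.
Proof. exact: sum_dim_weight. Qed.

Lemma massD n s : mass n s = mass n (false :: s) + mass n (true :: s).
Proof.
rewrite /mass (bigID (fun w => kernel_bit w (size s))) /= addrC.
by congr (_ + _); apply: eq_bigl => w;
  rewrite prefix_ofS eqseq_cons andbC; case: (kernel_bit w _).
Qed.

Lemma mass_le1 n s : mass n s <= 1.
Proof.
elim: s => [|b s IH]; first by rewrite mass_nil.
apply: le_trans IH; rewrite [mass n s]massD.
by case: b; rewrite (lerDl, lerDr) mass_ge0.
Qed.

Lemma sum_mass n j (F : seq bool -> R) :
  \sum_(w <- words n) dim_weight w * F (prefix_of (kernel_bit w) j) =
  \sum_(s <- bitseqs j) F s * mass n s.
Proof.
transitivity (\sum_(w <- words n) \sum_(s <- bitseqs j)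
    if prefix_of (kernel_bit w) (size s) == s then F s * dim_weight w else 0).
  apply: eq_bigr => w _;
    rewrite (bigD1_seq (prefix_of (kernel_bit w) j)) ?bitseqs_uniq//=.
    rewrite size_prefix_of eqxx mulrC big_seq_cond big1 ?addr0// => s /andP[].
    by rewrite mem_bitseqs => /eqP-> /negbTE; rewrite eq_sym => ->.
  by rewrite mem_bitseqs size_prefix_of.
rewrite exchange_big /=; apply: eq_bigr => s _.
by rewrite -big_mkcond /= -big_distrr.
Qed.

Lemma limit_mass : exists (g : nat -> nat) (m : seq bool -> R),
  (forall n, (n <= g n)%N) /\ forall s, mass (g n) s @[n --> \oo] --> m s.
Proof.
pose y n k : R := if choice.unpickle k is Some s then mass n s else 0.
have [|g [l [ng gl]]] := @bounded_subsequence R y.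
  move=> n k; rewrite /y; case: (choice.unpickle k) => [s|];
    last by rewrite lexx ler01.
  by rewrite mass_ge0 mass_le1.
exists g, (l \o choice.pickle); split=> // s.
by have := gl (choice.pickle s); rewrite /y choice.pickleK.
Qed.

End Representation.

Section MixtureExistence.
Variables (R : realType) (f : fword -> R).
Hypothesis f_nnh : nonneg_normalized_harmonic f.
Implicit Types (u v w : fword).

Lemma uniform_prob_itv (a b : R) : 0 <= a -> a <= b -> b <= 1 ->
  uniform_prob (@ltr01 R) `[a, b[%classic = (b - a)%:E.
Proof.
move=> a0 ab b1; rewrite /uniform_prob.
rewrite (eq_integral (fun=> 1%E)); last first.
  move=> x; rewrite inE /= in_itv /= => /andP[ax xb].
  by rewrite /uniform_pdf (le_trans a0 ax) (ltW (lt_le_trans xb b1)) /= subr0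
    invr1.
rewrite integral_cst//= mul1e lebesgue_measure_itv /= lte_fin.
case: ltP => [_|ba]; first by rewrite EFinB.
by rewrite (@le_anti _ _ a b) ?ab// subrr.
Qed.

Lemma bit_average_itv v L s : 0 <= bit_average R v L s <= 1.
Proof.
rewrite /bit_average mulr_ge0 ?invr_ge0 ?sumr_ge0//=.
have [->|L0] := posnP L; first by rewrite big_ord0 mulr0 ler01.
rewrite mulrC ler_pdivrMr ?ltr0n// mul1r -[X in _ <= X%:R]card_ord -sumr_const.
by apply: ler_sum => i _; rewrite lern1 leq_b1.
Qed.

Lemma bit_average_locate (m : seq bool -> R) v L t j k : (depth v L <= j <=
  k)%N ->
  bit_average R v L (locate m t k) = bit_average R v L (locate m t j).
Proof.
move=> /andP[dj jk]; rewrite -(subnK jk); elim: (k - j)%N => [|i IH] //=.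
by rewrite bit_average_cons// size_locate (leq_trans dj)// leq_addl.
Qed.

Lemma integral_representation : exists M : probability (borel_Omega R) R,
  forall v, f v = \int[M]_om phi_Omega om v.
Proof.
have [g [m [ng gm]]] := limit_mass f_nnh.
have m_nil : m [::] = 1.
  suff h : mass f (g n) [::] @[n --> \oo] --> (1 : R) by exact: (cvg_unique _
    (gm _) h).
  by under eq_cvg do rewrite (mass_nil f_nnh); exact: cvg_cst.
have mD s : m s = m (false :: s) + m (true :: s).
  suff h : mass f (g n) s @[n --> \oo] --> m (false :: s) + m (true :: s).
    exact: (cvg_unique _ (gm _) h).
  by under eq_cvg do rewrite massD; apply: cvgD; exact: gm.
have m_ge0 s : 0 <= m s.
  by apply: (ler_cvg_to (cvg_cst 0) (gm s)); apply: nearW => n; exact: mass_ge0.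
pose D : set R := `[0, 1[%classic.
have DE t : D t = (0 <= t < 1) by rewrite /D /= in_itv.
have /choice[W WP] t : exists om : Omega R,
    (0 <= t < 1 -> forall v L j, (0 < L)%N -> (depth v L <= j)%N ->
      `|phi_Omega om v - bit_average R v L (locate m t j)| <= L%:R^-1) /\
    (~ (0 <= t < 1) -> om = None).
  have [t01|nt] := pselect (0 <= t < 1); last by exists None.
  have /choice[x xP] j : exists w, (j <= wrank w)%N /\
      prefix_of (kernel_bit R w) j = locate m t j.
    (* A cylinder of positive limit mass has positive mass at some level [g n >= j], so it contains
       the code of a word of that rank. *)
    have mt := m_locate_gt0 m_nil mD j t01.
    have [N _ NP] : \forall n \near \oo, 0 < mass f (g n) (locate m t j).
      have /cvgrPdist_lt/(_ _ mt) := gm (locate m t j); apply: filterS => n.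
      by rewrite ltr_norml => /andP[_]; rewrite ltrBlDr -ltrBlDl subrr.
    have /= := NP (maxn j N) (leq_maxr _ _).
    set n := g _; have jn : (j <= n)%N by apply: leq_trans (ng _);
      exact: leq_maxl.
    move=> m0; apply: contrapT => /forallNP nw.
    move: m0; rewrite /mass big_seq_cond big1 ?ltxx// => w /andP[].
    rewrite mem_words size_locate => /eqP wn /eqP ws.
    by exfalso; apply: (nw w); rewrite wn.
  have [h [om [nh hom]]] := @martin_kernel_subsequence R x (fun n => (xP n).1).
  exists om; split=> // _ v L j L0 dj.
  have hc : `|martin_kernel R (x (h n)) v - bit_average R v L (locate m t j)|
    @[n --> \oo]
      --> `|phi_Omega om v - bit_average R v L (locate m t j)|.
    by apply: cvg_norm; apply: cvgB; [exact: hom|exact: cvg_cst].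
  apply: (ler_cvg_to hc (cvg_cst _)); exists j => // n /= jn.
  have jh : (j <= h n)%N := leq_trans jn (nh n).
  rewrite -(@bit_average_locate m v L t j (h n)) ?dj// -(xP (h n)).2.
  by apply: kernel_approx => //; exact: leq_trans dj jh.
pose I s : set R := `[left_end m s, left_end m s + m s[%classic.
have IE t s : I s t <-> 0 <= t < 1 /\ locate m t (size s) = s.
  rewrite /I /= in_itv /=; split; first exact: itv_locate.
  by move=> [t01 <-]; exact: locate_itv.
have mI s : measurable (I s) by exact: measurable_itv.
have mD' : measurable D by exact: measurable_itv.
have mW : measurable_fun setT (W : measurableTypeR R -> borel_Omega R).
  apply: (measurability _ (erefl : @measurable _ (borel_Omega R) = <<s @open
    (Omega R) >>)).
  move=> _ [U oU <-]; rewrite setTI.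
  (* The preimage of [U] is the countable union of the intervals whose prefix forces [W t] into [U],
     and the complement of [D] if P is in [U]. *)
  pose good s := forall t, 0 <= t < 1 -> locate m t (size s) = s -> U (W t).
  pose B k : set R := if (choice.unpickle k : option (seq bool)) is Some s then
    (if `[< good s >] then I s else set0) else set0.
  have mB k : measurable (B k).
    rewrite /B; case: (choice.unpickle k) => [s|]; last exact: measurable0.
    by case: ifP => _; [exact: mI|exact: measurable0].
  have WU t : 0 <= t < 1 -> U (W t) -> exists j, good (locate m t j).
    move=> t01 Ut; apply: contrapT => /forallNP ng'.
    (* If no prefix of [t] is good, there are points sharing ever longer prefixes with [t] but
       mapped outside [U]. Shared bits force [phi_Omega (W (t' n))] to converge to
       [phi_Omega (W t)], a contradiction. *)
    have /choice[t' t'P] j : exists t', [/\ 0 <= t' < 1,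
        locate m t' j = locate m t j & ~ U (W t')].
      apply: contrapT => /forallNP nt; apply: (ng' j) => t' t'01.
      rewrite size_locate => tt'; apply: contrapT => nU; exact: (nt t').
    have cv v : phi_Omega (W (t' n)) v @[n --> \oo] --> phi_Omega (W t) v.
      apply/cvgrPdist_le => e e0.
      pose L := (Num.truncn (2 / e)).+1.
      exists (depth v L) => // n /= dn; have [t'01 tt' _] := t'P n.
      have h1 := (WP t).1 t01 v L n (ltn0Sn _) dn.
      have h2 := (WP (t' n)).1 t'01 v L n (ltn0Sn _) dn.
      rewrite tt' distrC in h2.
      have Le : L%:R^-1 + L%:R^-1 <= e.
        have : 2 / e < L%:R by exact: truncnS_gt.
        rewrite ltr_pdivrMr// => h.
        have -> : L%:R^-1 + L%:R^-1 = 2 / L%:R :> R by rewrite mulrDl mul1r.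
        by rewrite ler_pdivrMr ?ltr0n// mulrC ltW.
      apply: le_trans Le; apply: le_trans (lerD h1 h2).
      by rewrite -[X in `|X|](subrKA (bit_average R v L (locate m t n)))
        ler_normD.
    have [N _ /(_ N (leqnn N))] := phi_Omega_cvg_open cv oU Ut.
    by have [_ _] := t'P N.
  have -> : W @^-1` U = (\bigcup_k B k) `|` (if `[< U None >] then ~` D else
    set0).
    apply/seteqP; split=> t /=.
      move=> Ut; have [t01|nt] := pselect (0 <= t < 1).
        have [j gj] := WU t t01 Ut.
        left; exists (choice.pickle (locate m t j)) => //.
        rewrite /B choice.pickleK; rewrite (asboolT gj).
        by apply/IE; rewrite size_locate.
      right; have UN : U None by move: Ut; rewrite (WP t).2.
      by rewrite (asboolT UN) /= DE.
    case=> [[k _]|].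
      rewrite /B; case: (choice.unpickle k) => // s; case: asboolP => // gs.
      by move=> /IE[t01 ts]; exact: gs.
    case: asboolP => // UN; rewrite /= DE => nt.
    by rewrite (WP t).2.
  apply: measurableU; first exact: bigcupT_measurable.
  by case: ifP => // _; exact: measurableC.
pose P0 : probability (measurableTypeR R) R := uniform_prob (@ltr01 R).
have P0_itv a b : 0 <= a -> a <= b -> b <= 1 -> P0 `[a, b[%classic = (b - a)%:E.
  exact: uniform_prob_itv.
pose X : {mfun measurableTypeR R >-> borel_Omega R} := mfun_Sub (mem_set mW).
exists (distribution P0 X) => v.
pose h t := phi_Omega (W t) v.
have mh : measurable_fun setT (h : measurableTypeR R -> R).
  exact: (measurableT_comp (measurable_phi_Omega v) mW).
have h01 t : 0 <= h t <= 1 by exact: phi_Omega_itv.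
have ih : P0.-integrable setT (EFin \o h) by exact: integrable_itv01.
have -> : \int[distribution P0 X]_om phi_Omega om v = \int[P0]_t h t.
  rewrite /Rintegral (integral_distribution (P := P0) (X := X))//.
  by apply/measurable_EFinP; exact: measurable_phi_Omega.
have P0D : P0 (~` D) = 0%E.
  rewrite (probability_setC P0 mD') P0_itv// subr0.
  exact: subee.
suff close L : (0 < L)%N -> `|f v - \int[P0]_t h t| <= 2 / L%:R.
  apply/eqP; rewrite -subr_eq0 -normr_eq0 eq_le normr_ge0 andbT.
  have c0 : 2 * n.+1%:R^-1 @[n --> \oo] --> (0 : R).
    by rewrite -[X in _ --> X](mulr0 (2 : R)); apply: cvgM;
      [exact: cvg_cst|exact: cvg_harmonic].
  by apply: (ler_cvg_to (cvg_cst _) c0); apply: nearW => n; exact: close.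
move=> L0; pose J := depth v L.
(* At a finite level [f v] is a mean of kernel values, each within [1/L] of its bit average; the
   bound passes to the limit masses. *)
have fJ : `|f v - \sum_(s <- bitseqs J) bit_average R v L s * m s| <= L%:R^-1.
  have cs : `|f v - \sum_(s <- bitseqs J) bit_average R v L s * mass f (g n) s|
    @[n --> \oo]
      --> `|f v - \sum_(s <- bitseqs J) bit_average R v L s * m s|.
    apply: cvg_norm; apply: cvgB; first exact: cvg_cst.
    by apply: cvgn_sum => s; apply: cvgM; [exact: cvg_cst|exact: gm].
  apply: (ler_cvg_to cs (cvg_cst _)); exists (wrank v) => // n /= vn.
  rewrite -sum_mass (sum_dim_weight_kernel f_nnh (leq_trans vn (ng n))) -sumrB.
  apply: le_trans (ler_norm_sum _ _ _) _.
  rewrite -[leRHS]mul1r -[X in X * _](sum_dim_weight f_nnh (g n)) big_distrl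
    /=; apply: ler_sum => w _.
  rewrite -mulrBr normrM ger0_norm ?(dim_weight_ge0 f_nnh)// ler_wpM2l
    ?(dim_weight_ge0 f_nnh)//.
  exact: kernel_approx.
pose step t : R := \sum_(s <- bitseqs J) bit_average R v L s * \1_(I s) t.
have mind s : measurable_fun setT (\1_(I s) : measurableTypeR R -> R).
  by apply: measurable_indic; exact: mI.
have istep s : P0.-integrable setT (EFin \o (fun t => bit_average R v L s *
  \1_(I s) t)).
  apply: integrable_itv01 => [|t].
    by apply: measurable_funM; [exact: measurable_cst|exact: mind].
  have /andP[a0 a1] := bit_average_itv v L s.
  by rewrite indicE; case: (_ \in _);
    rewrite ?mulr1 ?mulr0 ?a0 ?a1 ?lexx ?ler01.
have [istepT stepE] := Rintegral_sum (bitseqs J) istep.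
have {}stepE : \int[P0]_t step t = \sum_(s <- bitseqs J) bit_average R v L s *
  m s.
  rewrite /step stepE; apply: eq_bigr => s _; rewrite RintegralZl//; last first.
    by apply: integrable_itv01 => [|t]; [exact: mind|
      rewrite indicE; case: (_ \in _); rewrite ?lexx ?ler01].
  congr (_ * _);
    rewrite /Rintegral (integral_indic P0 measurableT (mI s)) setIT.
  have [l0 l1] := left_end_itv m_nil mD m_ge0 s.
  have PI : P0 (I s) = (m s)%:E by rewrite /I P0_itv ?lerDl// addrAC subrr
    add0r.
  exact: (congr1 fine PI).
(* Outside [D] the step function is 0 and [h] is at most 1; the added indicator absorbs this and has
   integral 0. *)
have hstep t : `|h t - step t| <= L%:R^-1 + \1_(~` D) t.
  have [t01|nt] := pselect (0 <= t < 1).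
    rewrite indicE memNset ?addr0; last by rewrite /= DE; case.
    have -> : step t = bit_average R v L (locate m t J).
      rewrite /step (bigD1_seq (locate m t J)) ?bitseqs_uniq//=; last first.
        by rewrite mem_bitseqs size_locate.
      rewrite indicE mem_set ?mulr1; last by apply/IE; rewrite size_locate.
      rewrite big_seq_cond big1 ?addr0// => s /andP[].
      rewrite mem_bitseqs => /eqP sJ /eqP ns.
      rewrite indicE memNset ?mulr0// => /IE[_]; rewrite sJ => e; exact: ns.
    exact: (WP t).1.
  rewrite indicE mem_set; last by rewrite /= DE.
  have -> : step t = 0.
    by rewrite /step big1// => s _; rewrite indicE memNset ?mulr0// => /IE[].
  rewrite subr0 ger0_norm; last by have /andP[] := h01 t.
  by apply: le_trans (_ : 1 <= _);
    [have /andP[] := h01 t|rewrite lerDr invr_ge0].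
have mN : measurable_fun setT (\1_(~` D) : measurableTypeR R -> R).
  exact/measurable_indic/measurableC.
have iN : P0.-integrable setT (EFin \o (\1_(~` D) : measurableTypeR R -> R)).
  apply: integrable_itv01 => // t.
  by rewrite indicE; case: (_ \in _); rewrite ?lexx ?ler01.
have ic : P0.-integrable setT (EFin \o (fun=> L%:R^-1 : R)).
  apply: integrable_itv01 => // t.
  by rewrite invr_ge0 ler0n invf_le1 ?ltr0n ?ler1n.
have ihs : P0.-integrable setT (EFin \o (fun t => h t - step t)).
  exact: (integrableB measurableT ih istepT).
have iabs : P0.-integrable setT (EFin \o (fun t => `|h t - step t|)).
  exact: (integrable_norm ihs).
have hs : `|\int[P0]_t h t - \int[P0]_t step t| <= L%:R^-1.
  rewrite -RintegralB//; apply: le_trans (le_normr_Rintegral _ _) _ => //.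
  apply: le_trans (le_Rintegral _ iabs (integrableD measurableT ic iN) _) _ =>
    //.
  rewrite RintegralD// Rintegral_cst// [fine _](congr1 fine (probability_setT
    P0)) mulr1.
  rewrite [X in _ + X]/Rintegral (integral_indic P0 measurableT (measurableC
    mD')) setIT.
  by rewrite [fine _](congr1 fine P0D) addr0.
rewrite stepE in hs.
rewrite (_ : 2 / L%:R = L%:R^-1 + L%:R^-1); last by rewrite mulrDl mul1r.
apply: le_trans (lerD fJ hs).
rewrite [X in _ <= _ + X]distrC.
by rewrite -[X in `|X|](subrKA (\sum_(s <- bitseqs J) bit_average R v L s * m
  s)) ler_normD.
Qed.
End MixtureExistence.

Theorem theorem3p2 (R : realType) :
  [/\ homeomorphism_onto (@phi_Omega R) (martin_boundary R),
      forall M : probability (borel_Omega R) R,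
        (forall v : fword,
           M.-integrable [set: borel_Omega R] (fun o => (phi_Omega o v)%:E)) /\
        nonneg_normalized_harmonic (fun v => \int[M]_o phi_Omega o v)
    & forall f : fword -> R, nonneg_normalized_harmonic f ->
        exists M : probability (borel_Omega R) R,
          forall v : fword, f v = \int[M]_o phi_Omega o v].
Proof.
split; first exact: homeomorphism_phi_Omega.
  move=> M; split; first exact: integrable_phi_Omega.
  exact: mixture_harmonic.
exact: integral_representation.
Qed.
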